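(* (1) There exists an elusive finite transitive permutation group $X$ of degree $5^2\cdot 3^2=225$ such that $X$ has a normal subgroup $N\cong \mathrm{C}_3^4\times \mathrm{C}_5^3$ with $X/N\cong \mathrm{A}_5$, $X$ does not split over $N$, and the point stabilizer of $X$ is isomorphic to a semidirect product $(\mathrm{C}_3^3\times\mathrm{C}_5^2){:}\mathrm{C}_2^2$. (2) There exists an elusive finite transitive permutation group $X$ of degree $5^2\cdot 3^2\cdot 2=450$ such that $X$ has a normal subgroup $N\cong \mathrm{C}_3^4\times \mathrm{C}_5^3$ with $X/N\cong \mathrm{A}_5$, $X$ does not split over $N$, and the point stabilizer of $X$ is isomorphic to a semidirect product $(\mathrm{C}_3^3\times\mathrm{C}_5^2){:}\mathrm{C}_2$.
   Context: All permutation groups act on finite sets. A derangement is a permutation with no fixed points. A transitive permutation group is elusive if it contains no derangements of prime order. $\mathrm{C}_n$ denotes the cyclic group of order $n$, $\mathrm{A}_5$ the alternating group of degree 5, and $A{:}B$ a semidirect product of a normal subgroup $A$ by $B$. ''$X$ does not split over $N$'' means $N$ has no complement in $X$. *)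

(* Defs.v *)
From mathcomp Require Import all_boot all_fingroup all_solvable all_algebra.
Set Implicit Arguments. Unset Strict Implicit. Unset Printing Implicit Defensive.

(* Cyclic group C_n as the additive group of 'Z_n (n >= 2 in all uses). *)
Definition Cyc (n : nat) : finGroupType := 'Z_n.

Definition C3_3 : finGroupType := (Cyc 3 * Cyc 3 * Cyc 3)%type.
Definition C3_4 : finGroupType := (C3_3 * Cyc 3)%type.
Definition C5_2 : finGroupType := (Cyc 5 * Cyc 5)%type.
Definition C5_3 : finGroupType := (C5_2 * Cyc 5)%type.
Definition C2_2 : finGroupType := (Cyc 2 * Cyc 2)%type.
Definition NType : finGroupType := (C3_4 * C5_3)%type.
Definition KType : finGroupType := (C3_3 * C5_2)%type.

Definition elusive (n : nat) (X : {group {perm 'I_n}}) : Prop :=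
  [transitive X, on [set: 'I_n] | 'P] /\
  forall x : {perm 'I_n}, x \in X -> prime #[x]%g -> exists i : 'I_n, x i = i.

(* Main.v *)
(* The degree 4 deleted permutation module V3 over F_3 and the 3-dimensional module V5 over F_5
   of A_5 both have non-split extensions by A_5 in which every preimage of an element of
   order 3 (resp. 5) has order 9 (resp. 25).  The first consists of the monomial 5 x 5 matrices
   of determinant 1 over the 9th roots of unity lying over the monomial representation of A_5
   induced from a cubic character of A_4; the second is the preimage of A_5 < SO_3(5) in
   SO_3(Z/25).  Let G be their fibre product over A_5, and N = V3 x V5 its kernel: all elements
   of order 3 or 5 of G lie in N, so G does not split over N.  A Klein four-group Q of G
   normalises a hyperplane of V3 and a hyperplane of V5 whose A_5-conjugates cover V3 and V5;
   if K is the product of the two hyperplanes, every element of order 3 or 5 is conjugate into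
   K, and all involutions are conjugate into any subgroup of order 2 of Q.  Hence G acts
   elusively and faithfully on the cosets of K Q (degree 225) and of K C_2 (degree 450). *)

From HB Require Import structures.
Require Import Defs.
From mathcomp Require Import all_boot all_fingroup all_solvable all_algebra.
Set Implicit Arguments. Unset Strict Implicit. Unset Printing Implicit Defensive.
Import GRing.Theory.

(** * Explicit matrices and permutations, in a form suited to computation *)

(* Entries modulo 25 as lists of naturals: 'M['Z_25]_3 does not reduce under vm_compute. *)
Definition lmatrix := seq (seq nat).

Definition lentry (a : lmatrix) i j := nth 0 (nth [::] a i) j.

Definition lbuild (f : nat -> nat -> nat) : lmatrix :=
  [seq [seq f i j | j <- iota 0 3] | i <- iota 0 3].

Definition lmul (a b : lmatrix) : lmatrix :=
  lbuild (fun i j => (lentry a i 0 * lentry b 0 j + lentry a i 1 * lentry b 1 j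
                      + lentry a i 2 * lentry b 2 j) %% 25).

Definition ltr (a : lmatrix) : lmatrix := lbuild (fun i j => lentry a j i).

Definition l1 : lmatrix := lbuild (fun i j => (i == j) : nat).

(** For [k = 1] this is equality modulo 25, for [k = 5] congruence modulo 5. *)
Definition lcong k (a b : lmatrix) : bool :=
  all (fun i => all (fun j =>
    (lentry a i j * k) %% 25 == (lentry b i j * k) %% 25) (iota 0 3)) (iota 0 3).

(** The diagonal four-group of A_4; 24 stands for -1. *)
Definition lsign (v : nat) : lmatrix :=
  nth l1 [:: l1; [:: [:: 1; 0; 0]; [:: 0; 24; 0]; [:: 0; 0; 24]];
                 [:: [:: 24; 0; 0]; [:: 0; 1; 0]; [:: 0; 0; 24]];
                 [:: [:: 24; 0; 0]; [:: 0; 24; 0]; [:: 0; 0; 1]]] v.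

Definition lcyc : lmatrix := [:: [:: 0; 1; 0]; [:: 0; 0; 1]; [:: 1; 0; 0]].

(* The matrices [lmono v c] form A_4; [c] modulo 3 is its cubic character. *)
Definition lmono (v c : nat) : lmatrix := lmul (lsign v) (iter (c %% 3) (lmul lcyc) l1).

(** An orthogonal matrix modulo 25 whose reduction modulo 5 has order 5; it lies over the 5-cycle
    [lcyc5]. *)
Definition lrot : lmatrix := [:: [:: 4; 1; 3]; [:: 1; 18; 1]; [:: 22; 24; 21]].

(* Representatives of the cosets of A_4 in A_5.  The factors [lcyc] make the monomial part of
   the four-group of [lsign] matrices trivial. *)
Definition lframe (i : nat) : lmatrix :=
  nth l1 [:: l1; lrot; lmul lcyc (iter 2 (lmul lrot) l1);
             lmul lcyc (iter 3 (lmul lrot) l1); iter 4 (lmul lrot) l1] i.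

Definition lpairing1 : seq nat := [:: 0; 2; 1; 4; 3].
Definition lpairing2 : seq nat := [:: 0; 3; 4; 1; 2].
Definition lcyc3 : seq nat := [:: 0; 2; 4; 3; 1].
Definition lcyc5 : seq nat := [:: 1; 2; 3; 4; 0].
(** Exponents of the 9th root of unity in the monomial matrices over these permutations. Each list
    sums to 0 modulo 9, which gives determinant 1, and modulo 3 it is dictated by the cubic
    character of the matrix chosen over the same permutation. *)
Definition shift1 : seq nat := [:: 0; 0; 0; 0; 0].
Definition shift3 : seq nat := [:: 1; 2; 2; 2; 2].
Definition shift5 : seq nat := [:: 0; 8; 0; 1; 0].

Definition ord5 (k : nat) : 'I_5 := inZp k.

(** A basis of the sum-zero vectors of F_3^5. The first three span the hyperplane with equation
    [L 1 + L 2 + 2 * (L 3 + L 4) = 0], and this form takes the value 1 on the fourth. *)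
Definition lcoef : seq (seq nat) :=
  [:: [:: 0; 1; 2; 0; 0]; [:: 0; 0; 0; 1; 2]; [:: 1; 2; 2; 2; 2]; [:: 0; 1; 1; 2; 2]].
Definition coef k (i : 'I_5) : nat := nth 0 (nth [::] lcoef k) i.
(** The general orthogonal matrix congruent to 1 modulo 5; 20 stands for -5. *)
Definition lskew (y0 y1 y2 : nat) : lmatrix :=
  [:: [:: 1; 5 * y0; 5 * y1]; [:: 20 * y0; 1; 5 * y2]; [:: 20 * y1; 20 * y2; 1]].

Definition shiftcoef (a b c t i : nat) : nat :=
  let k j := nth 0 (nth [::] lcoef j) i in (a * k 0 + b * k 1 + c * k 2 + t * k 3).

(* Whether the conjugate of a kernel element by the inverse of an element of the group with
   permutation [f] and matrix [l] satisfies the equations of the two hyperplanes. *)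
Definition conj3 (f : nat -> nat) a b c t : bool :=
  let L k := shiftcoef a b c t (f k) in 3 %| L 1 + L 2 + 2 * (L 3 + L 4).
Definition conj5 (l : lmatrix) y0 y1 y2 : bool :=
  lentry (lmul (lmul l (lskew y0 y1 y2)) (ltr l)) 1 2 == 0.

Definition sweep_perm (j i k : nat) : nat :=
  iter i (nth 0 lcyc5) (iter j (nth 0 lcyc3) k).
Definition sweep_mx (j i : nat) : lmatrix :=
  lmul (iter j (lmul lcyc) l1) (iter i (lmul lrot) l1).

Local Open Scope group_scope.

(** * From a group with a suitable subgroup to an elusive action on cosets *)

Section CosetAction.

Variables (gT : finGroupType) (G H : {group gT}).
Hypothesis sHG : H \subset G.

Lemma mem_rcosets_sub x : (H :* x \in rcosets H G) = (x \in G).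
Proof. by rewrite mem_rcosets mulSGid. Qed.

Let S1 : H :* 1 \in rcosets H G.
Proof. by rewrite mem_rcosets_sub. Qed.

(** Cosets are numbered by their enumeration, so that the action is by permutations of an ordinal
    type. Outside [G] the identity is a harmless default that keeps the map injective. *)
Definition coset_act (x : gT) (i : 'I_#|G : H|) : 'I_#|G : H| :=
  if x \in G then enum_rank_in S1 (enum_val i :* x) else i.

Lemma enum_val_coset_act x i :
  x \in G -> enum_val (coset_act x i) = enum_val i :* x.
Proof.
move=> Gx; rewrite /coset_act Gx enum_rankK_in //.
have /rcosetsP[y Gy ->] := enum_valP i.
by rewrite -rcosetM mem_rcosets_sub groupM.
Qed.

Lemma coset_act_inj x : injective (coset_act x).
Proof.
have [Gx | nGx] := boolP (x \in G); last first.
  by move=> i j; rewrite /coset_act (negPf nGx).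
move=> i j /(congr1 enum_val); rewrite !enum_val_coset_act // => eq_ij.
exact/enum_val_inj/(rcoset_inj eq_ij).
Qed.

Definition coset_perm x := perm (@coset_act_inj x).

Lemma enum_val_coset_perm x i :
  x \in G -> enum_val (coset_perm x i) = enum_val i :* x.
Proof. by move=> Gx; rewrite permE enum_val_coset_act. Qed.

Lemma coset_permM : {in G &, {morph coset_perm : x y / x * y}}.
Proof.
move=> x y Gx Gy; apply/permP=> i; apply: enum_val_inj.
by rewrite permM !enum_val_coset_perm ?groupM // rcosetM.
Qed.

Canonical coset_perm_morphism := Morphism coset_permM.

Lemma coset_perm_trans (i j : 'I_#|G : H|) :
  exists2 x, x \in G & coset_perm x i = j.
Proof.
have /rcosetsP[x Gx def_i] := enum_valP i.
have /rcosetsP[y Gy def_j] := enum_valP j.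
exists (x^-1 * y); first by rewrite groupM ?groupV.
apply: enum_val_inj; rewrite enum_val_coset_perm ?groupM ?groupV //.
by rewrite def_i def_j -rcosetM mulgA mulgV mul1g.
Qed.

Definition coset_point g : 'I_#|G : H| := enum_rank_in S1 (H :* g).

Lemma coset_pointP i : exists2 g, g \in G & i = coset_point g.
Proof.
have /rcosetsP[g Gg def_i] := enum_valP i; exists g => //.
by rewrite /coset_point -def_i enum_valK_in.
Qed.

Lemma coset_perm_fix x g : x \in G -> g \in G ->
  (coset_perm x (coset_point g) == coset_point g) = (x \in H :^ g).
Proof.
move=> Gx Gg; rewrite -(inj_eq enum_val_inj) enum_val_coset_perm //.
rewrite enum_rankK_in ?mem_rcosets_sub // -rcosetM mem_conjg conjgE invgK mulgA.
by apply/eqP/idP => [/rcoset_eqP|Hgx]; last apply/rcoset_eqP; rewrite mem_rcoset.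
Qed.

Lemma coset_perm_inj : gcore H G = 1 -> 'injm coset_perm.
Proof.
move=> coreH; apply/subsetP=> x kx; have Gx := dom_ker kx; rewrite -coreH.
apply/bigcapP=> g Gg; rewrite -coset_perm_fix //.
by have /= -> := mker kx; rewrite perm1.
Qed.

(** The trivial core makes the action faithful, so [N], the quotient and non-splitting carry over to
    the image. The stabilizer of the coset of [g] is [H :^ g]: conjugacy into [H] thus yields fixed
    points, and every stabilizer inherits the decomposition of [H]. *)
Lemma elusive_coset_perm (N K Q : {group gT}) (aT rT kT qT : finGroupType)
    (R : {group rT}) :
    gcore H G = 1 ->
    (forall x, x \in G -> prime #[x] -> exists2 g, g \in G & x ^ g \in H) ->
    N <| G -> N \isog [set: aT] -> G / N \isog R -> ~~ [splits G, over N] ->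
    K ><| Q = H -> K \isog [set: kT] -> Q \isog [set: qT] ->
  exists X : {group {perm 'I_#|G : H|}}, elusive X /\
    exists N : {group {perm 'I_#|G : H|}},
    [/\ N <| X, N \isog [set: aT], X / N \isog R, ~~ [splits X, over N] &
      forall i : 'I_#|G : H|, exists K Q : {group {perm 'I_#|G : H|}},
        [/\ K ><| Q = 'C_X[i | 'P], K \isog [set: kT] & Q \isog [set: qT]]].
Proof.
move=> coreH elH nNG isoN isoGN nsplit defH isoK isoQ.
have injf := coset_perm_inj coreH; pose f := coset_perm_morphism.
have sNG := normal_sub nNG.
exists (f @* G)%G; split; first split.
- apply/imsetP; exists (coset_point 1) => //.
  apply/setP=> j; rewrite in_setT; apply/esym.
  have [x Gx <-] := coset_perm_trans (coset_point 1) j.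
  by apply/imsetP; exists (f x); rewrite ?mem_morphim.
- move=> _ /morphimP[x _ Gx ->]; rewrite (order_injm injf) // => /(elH x Gx).
  case=> g Gg Hxg; exists (coset_point g^-1); apply/eqP.
  by rewrite coset_perm_fix ?groupV // mem_conjgV.
exists (f @* N)%G; split.
- exact: morphim_normal.
- by rewrite isog_sym (isog_trans _ (sub_isog sNG injf)) // isog_sym.
- have nfNG : f @* G \subset 'N(f @* N) by rewrite morphim_norms ?normal_norm.
  apply: isog_trans isoGN; rewrite isog_sym.
  have := injm_quotm nNG injf => injq.
  have := sub_isog (subxx (G / N)) injq; rewrite morphim_quotm => isoq.
  exact: isoq.
- apply: contra nsplit => /splitsP[C /complP[tiC defX]].
  have sCX : C \subset f @* G by rewrite -defX mulG_subr.
  (* The preimage of a complement in the image is a complement of [N] in [G]. *)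
  apply/splitsP; exists (f @*^-1 C)%G; apply/complP; split.
    apply/eqP; rewrite -(morphim_injm_eq1 injf) ?subIset ?sNG ?subxx //=.
    rewrite -subG1 -tiC subsetI morphimS ?subsetIl //=.
    by rewrite (subset_trans (morphimS _ (subsetIr _ _))) // morphpreK.
  apply/eqP; rewrite eqEsubset mul_subG ?subsetIl //=.
  apply/subsetP=> x Gx; have: f x \in f @* N * C by rewrite defX mem_morphim.
  case/mulsgP=> _ c /morphimP[n Gn Nn ->] Cc /= fx; apply/mulsgP.
  exists n (n^-1 * x) => //; last by rewrite mulKVg.
  have Gnx : n^-1 * x \in G by rewrite groupM ?groupV.
  by rewrite !inE Gnx /= morphM ?morphV ?groupV //= fx mulKg.
move=> i; have [g Gg ->] := coset_pointP i.
have sHgG : H :^ g \subset G by rewrite -(conjGid Gg) conjSg.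
have [/andP[sKH _] sQH _ _] := sdprod_context defH.
exists (f @* (K :^ g))%G, (f @* (Q :^ g))%G; split.
- rewrite (injm_sdprod (G := (H :^ g)%G)) -?sdprodJ ?defH //.
  apply/setP=> y; apply/idP/setIP => [|[/morphimP[x _ Gx ->]]].
    case/morphimP=> x Gx Hx ->; rewrite mem_morphim //; split=> //.
    by apply/astab1P/eqP; rewrite /= /aperm coset_perm_fix.
  move/astab1P/eqP; rewrite /= /aperm coset_perm_fix // => Hx.
  exact: mem_morphim.
- apply: isog_trans isoK; rewrite isog_sym (isog_trans (conj_isog K g)) //.
  by rewrite sub_isog // (subset_trans _ sHgG) ?conjSg.
- apply: isog_trans isoQ; rewrite isog_sym (isog_trans (conj_isog Q g)) //.
  by rewrite sub_isog // (subset_trans _ sHgG) ?conjSg.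
Qed.

End CosetAction.

(** * Passage between lists and matrices over Z/25 *)

Definition lmx (a : lmatrix) : 'M['Z_25]_3 := (\matrix_(i, j) (lentry a i j)%:R)%R.

Lemma lentry_build f i j : i < 3 -> j < 3 -> lentry (lbuild f) i j = f i j.
Proof. by case: i => [|[|[|]]] // _; case: j => [|[|[|]]]. Qed.

Lemma Z25_nat_eq m n : (m%:R == n%:R :> 'Z_25)%R = (m == n %[mod 25]).
Proof. by rewrite -val_eqE /= !(@val_Zp_nat 25). Qed.

Lemma lmx_mul a b : (lmx a *m lmx b)%R = lmx (lmul a b).
Proof.
apply/matrixP=> i j; rewrite !mxE lentry_build //.
rewrite !big_ord_recl big_ord0 !mxE addr0 -!natrM -!natrD.
by apply/eqP; rewrite Z25_nat_eq modn_mod !addnA.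
Qed.

Lemma lmx_tr a : ((lmx a)^T)%R = lmx (ltr a).
Proof. by apply/matrixP=> i j; rewrite !mxE lentry_build. Qed.

Lemma lmx1 : lmx l1 = 1%:M%R.
Proof. by apply/matrixP=> i j; rewrite !mxE lentry_build. Qed.

Lemma iota_ord n (i : 'I_n) : val i \in iota 0 n.
Proof. by rewrite mem_iota ltn_ord. Qed.

(** This lets [vm_compute] decide congruences between matrices over Z/25. *)
Lemma lmx_cong k a b : (lmx a *+ k == lmx b *+ k)%R = lcong k a b.
Proof.
have E (c : lmatrix) i j : (lmx c *+ k)%R i j = (lentry c i j * k)%:R%R.
  by rewrite mulmxnE mxE natrM mulr_natr.
apply/eqP/allP => [eq_ab i | eq_ab].
  rewrite mem_iota => lt_i; apply/allP=> j; rewrite mem_iota => lt_j.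
  have := congr1 (fun M : 'M_3 => M (@Ordinal 3 i lt_i) (@Ordinal 3 j lt_j)) eq_ab.
  by rewrite /= !E => /eqP; rewrite Z25_nat_eq.
apply/matrixP=> i j; rewrite !E; apply/eqP; rewrite Z25_nat_eq.
exact: (allP (eq_ab _ (iota_ord i)) _ (iota_ord j)).
Qed.

Lemma lmx_eq a b : (lmx a == lmx b) = lcong 1 a b.
Proof. by rewrite -lmx_cong !mulr1n. Qed.

(** * The ambient group: monomial matrices over 9th roots of unity times orthogonal matrices over
    Z/25 *)

Definition orth3 := {M : 'M['Z_25]_3 | (M *m M^T == 1%:M)%R}.
HB.instance Definition _ := Finite.on orth3.
Definition Orth3 M (orthM : (M *m M^T == 1%:M)%R) : orth3 :=
  exist (fun M => is_true (M *m M^T == 1%:M)%R) M orthM.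

Fact orth3_mul_proof (M N : orth3) :
  ((val M *m val N) *m (val M *m val N)^T == 1%:M)%R.
Proof.
rewrite trmx_mul mulmxA -(mulmxA (val M)) (eqP (valP N)) mulmx1.
exact: valP M.
Qed.
Definition orth3_mul M N : orth3 := Orth3 (orth3_mul_proof M N).

Fact orth3_one_proof : ((1%:M : 'M['Z_25]_3) *m (1%:M)^T == 1%:M)%R.
Proof. by rewrite trmx1 mulmx1. Qed.
Definition orth3_one : orth3 := Orth3 orth3_one_proof.

Fact orth3_inv_proof (M : orth3) : ((val M)^T *m ((val M)^T)^T == 1%:M)%R.
Proof. by rewrite trmxK; apply/eqP/mulmx1C/eqP/(valP M). Qed.
Definition orth3_inv M : orth3 := Orth3 (orth3_inv_proof M).

Fact orth3_mulA : associative orth3_mul.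
Proof. by move=> M N P; apply: val_inj; rewrite /= mulmxA. Qed.
Fact orth3_mul1 : left_id orth3_one orth3_mul.
Proof. by move=> M; apply: val_inj; rewrite /= mul1mx. Qed.
Fact orth3_mulV : left_inverse orth3_one orth3_inv orth3_mul.
Proof. by move=> M; apply: val_inj; apply/mulmx1C/eqP/(valP M). Qed.
HB.instance Definition _ := Finite_isGroup.Build orth3 orth3_mulA orth3_mul1 orth3_mulV.

(* [(d, s)] is the monomial matrix with entry [z ^ d i] at [(i, s i)], [z] of order 9. *)
Definition wreath9 := ({ffun 'I_5 -> 'Z_9} * {perm 'I_5})%type.
HB.instance Definition _ := Finite.on wreath9.

Definition wreath9_mul (x y : wreath9) : wreath9 :=
  ([ffun i => x.1 i + y.1 (x.2 i)]%R, x.2 * y.2).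
Definition wreath9_one : wreath9 := ([ffun=> 0%R], 1).
Definition wreath9_inv (x : wreath9) : wreath9 :=
  ([ffun i => - x.1 (x.2^-1%g i)]%R, x.2^-1).

Fact wreath9_mulA : associative wreath9_mul.
Proof.
move=> x y z; congr (_, _); last exact: mulgA.
by apply/ffunP=> i; rewrite !ffunE permM addrA.
Qed.
Fact wreath9_mul1 : left_id wreath9_one wreath9_mul.
Proof.
move=> [d s]; congr (_, _); last exact: mul1g.
by apply/ffunP=> i; rewrite !ffunE perm1 add0r.
Qed.
Fact wreath9_mulV : left_inverse wreath9_one wreath9_inv wreath9_mul.
Proof.
move=> [d s]; congr (_, _); last exact: mulVg.
by apply/ffunP=> i; rewrite !ffunE /= addNr.
Qed.
HB.instance Definition _ :=
  Finite_isGroup.Build wreath9 wreath9_mulA wreath9_mul1 wreath9_mulV.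

Definition ambient : finGroupType := (wreath9 * orth3)%type.

Definition ashift (x : ambient) (i : 'I_5) : 'Z_9 := x.1.1 i.
Definition aperm5 (x : ambient) : {perm 'I_5} := x.1.2.
Definition amx (x : ambient) : 'M['Z_25]_3 := val x.2.

Lemma ashiftM x y i : ashift (x * y) i = (ashift x i + ashift y (aperm5 x i))%R.
Proof. exact: ffunE. Qed.
Lemma aperm5M x y : aperm5 (x * y) = aperm5 x * aperm5 y.
Proof. by []. Qed.
Lemma amxM x y : amx (x * y) = (amx x *m amx y)%R.
Proof. by []. Qed.
Lemma ashift1 i : ashift 1 i = 0%R.
Proof. exact: ffunE. Qed.
Lemma aperm51 : aperm5 1 = 1.
Proof. by []. Qed.
Lemma amx1 : amx 1 = 1%:M%R.
Proof. by []. Qed.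
Lemma ashiftV x i : ashift x^-1 i = (- ashift x ((aperm5 x)^-1 i)%g)%R.
Proof. exact: ffunE. Qed.
Lemma aperm5V x : aperm5 x^-1 = (aperm5 x)^-1.
Proof. by []. Qed.
Lemma amxV x : amx x^-1 = (amx x)^T%R.
Proof. by []. Qed.
Lemma amx_tr x : (amx x *m (amx x)^T)%R = 1%:M%R.
Proof. exact/eqP/(valP x.2). Qed.

Lemma ambient_inj x y :
  ashift x =1 ashift y -> aperm5 x = aperm5 y -> amx x = amx y -> x = y.
Proof.
move: x y => [[d s] M] [[e t] P] eq_de eq_st /val_inj eq_MP.
by congr (_, _, _); first apply/ffunP.
Qed.

(** * The fibre product over A_5 *)

Definition frame (i : 'I_5) := lmx (lframe i).

Lemma mulmxMnl m n p k (A : 'M['Z_25]_(m, n)) (B : 'M_(n, p)) :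
  (A *m B *+ k = (A *+ k) *m B)%R.
Proof. by rewrite -!scaler_nat scalemxAl. Qed.

Lemma mulmxMnr m n p k (A : 'M['Z_25]_(m, n)) (B : 'M_(n, p)) :
  (A *m B *+ k = A *m (B *+ k))%R.
Proof. by rewrite -!scaler_nat scalemxAr. Qed.

(* Congruence modulo 5 of matrices over Z/25 is expressed as equality after multiplication
   by 5. *)
Definition mono5 (c : nat) (M : 'M['Z_25]_3) : bool :=
  has (fun v => M *+ 5 == lmx (lmono v c) *+ 5)%R (iota 0 4).

(** The multiplication table of A_4 modulo 5 is checked exhaustively, which is enough because
    [lmono] depends on its exponent only modulo 3. *)
Lemma mono5M c d M N : mono5 c M -> mono5 d N -> mono5 (c + d) (M *m N)%R.
Proof.
move=> /hasP[v v4 /eqP eM] /hasP[w w4 /eqP eN].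
have /allP chk : all (fun v => all (fun w => all (fun c => all (fun d =>
    has (fun u => lcong 5 (lmul (lmono v c) (lmono w d)) (lmono u (c + d)))
      (iota 0 4)) (iota 0 3)) (iota 0 3)) (iota 0 4)) (iota 0 4) by vm_compute.
have lmono3 u e : lmono u e = lmono u (e %% 3) by rewrite /lmono modn_mod.
have mod3 e : e %% 3 \in iota 0 3 by rewrite mem_iota ltn_mod.
have /hasP[u u4] := allP (allP (allP (chk v v4) w w4) _ (mod3 c)) _ (mod3 d).
rewrite -lmx_cong -lmx_mul => /eqP eu; apply/hasP; exists u => //.
rewrite (lmono3 u (c + d)) -(modnDm c d) -(lmono3 u) -eu -!lmono3.
by rewrite mulmxMnl eM -mulmxMnl mulmxMnr eN -mulmxMnr.
Qed.

Lemma mono5_congr c d M : c = d %[mod 3] -> mono5 c M = mono5 d M.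
Proof. by rewrite /mono5 /lmono => ->. Qed.

Lemma frame_tr i : (frame i *m (frame i)^T)%R = 1%:M%R.
Proof.
apply/eqP; rewrite lmx_tr lmx_mul -lmx1 lmx_eq.
by case: i => [[|[|[|[|[|i]]]]] lt_i] //; vm_compute.
Qed.

(* The images of [x] in the two extensions agree over A_5: the matrix sends frame [i] to frame
   [aperm5 x i], shifting its three axes cyclically by [ashift x i]. *)
Definition respects (x : ambient) i : bool :=
  mono5 (ashift x i) (frame i *m amx x *m (frame (aperm5 x i))^T)%R.

(** The sum condition is determinant 1 for the monomial part. The matrix part has determinant 1 too:
    its determinant has square 1, and [respects] makes it 1 modulo 5. *)
Definition elusive_set : {set ambient} :=
  [set x | [&& ~~ (aperm5 x : bool), \sum_i ashift x i == 0 & [forall i, respects x i]]%R].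

Lemma elusive_setP x : reflect
  [/\ ~~ (aperm5 x : bool), (\sum_i ashift x i = 0)%R & forall i, respects x i]
  (x \in elusive_set).
Proof.
rewrite inE; apply: (iffP and3P) => [[-> /eqP -> /forallP] | [-> -> resp]] //.
by split=> //; apply/forallP.
Qed.

(** The condition for [x] at [i] multiplies with the one for [y] at [aperm5 x i], because the
    orthogonal frame between them cancels. *)
Lemma elusive_group_set : group_set elusive_set.
Proof.
apply/group_setP; split=> [|x y /elusive_setP[ex sx rx] /elusive_setP[ey sy ry]].
  apply/elusive_setP; split=> [||i].
  - by rewrite aperm51 odd_perm1.
  - by rewrite big1 // => i _; rewrite ashift1.
  rewrite /respects ashift1 aperm51 perm1 amx1 mulmx1 frame_tr -lmx1.
  by apply/hasP; exists 0%N; rewrite // lmx_cong; vm_compute.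
apply/elusive_setP; split=> [||i].
- by rewrite aperm5M odd_permM (negPf ex) (negPf ey).
- under eq_bigr do rewrite ashiftM.
  rewrite big_split /= sx add0r -[RHS]sy [RHS](reindex_inj (@perm_inj _ (aperm5 x))).
  by [].
have := mono5M (rx i) (ry (aperm5 x i)).
rewrite /respects ashiftM aperm5M permM amxM !mulmxA -(mulmxA _ (_^T) (frame _)).
rewrite (mulmx1C (frame_tr _)) mulmx1 -!mulmxA.
(* The sum in Z/9 is reduced modulo 9, which does not change it modulo 3. *)
by rewrite (@mono5_congr _ (ashift x i + ashift y (aperm5 x i))%R) //= modn_dvdm.
Qed.

Canonical elusive_group := Group elusive_group_set.

(** * Explicit elements over generators of A_5 *)

Fact lmx_orth l : lcong 1 (lmul l (ltr l)) l1 -> (lmx l *m (lmx l)^T == 1%:M)%R.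
Proof. by rewrite lmx_tr lmx_mul -lmx1 lmx_eq. Qed.

Definition explicit (d : seq nat) (s : {perm 'I_5}) (l : lmatrix)
    (orth_l : lcong 1 (lmul l (ltr l)) l1) : ambient :=
  ([ffun i : 'I_5 => (nth 0%N d i)%:R%R], s, Orth3 (lmx_orth orth_l)).

Lemma explicit_in d (s : {perm 'I_5}) l orth_l sl :
    ~~ (s : bool) -> (forall i, nat_of_ord (s i) = nth 0%N sl i) ->
    (\sum_(i < 5) nth 0 d i)%N %% 9 = 0%N ->
    all (fun i => has (fun v => lcong 5 (lmul (lmul (lframe i) l) (ltr (lframe (nth 0 sl i))))
         (lmono v (nth 0 d i))) (iota 0 4)) (iota 0 5) ->
  @explicit d s l orth_l \in elusive_group.
Proof.
move=> even_s def_s sum_d resp; apply/elusive_setP; split=> // [|i].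
  under eq_bigr do rewrite /ashift ffunE.
  by rewrite -natr_sum; apply: val_inj; rewrite /= (@val_Zp_nat 9).
rewrite /respects /ashift /= ffunE.
have /hasP[v v4 eq_v] := allP resp i (iota_ord i).
rewrite (@mono5_congr _ (nth 0%N d i)); last first.
  by rewrite (@val_Zp_nat 9) // modn_dvdm.
by apply/hasP; exists v; rewrite // /frame def_s lmx_tr !lmx_mul lmx_cong.
Qed.

Definition perm_pairing1 := tperm (ord5 1) (ord5 2) * tperm (ord5 3) (ord5 4).
Definition perm_pairing2 := tperm (ord5 1) (ord5 3) * tperm (ord5 2) (ord5 4).
Definition perm_cyc3 := tperm (ord5 1) (ord5 2) * tperm (ord5 1) (ord5 4).
Definition perm_cyc5 := tperm (ord5 0) (ord5 1) * tperm (ord5 0) (ord5 2) *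
  tperm (ord5 0) (ord5 3) * tperm (ord5 0) (ord5 4).

Lemma perm_pairing1E i : nat_of_ord (perm_pairing1 i) = nth 0%N lpairing1 i.
Proof. by case: i => [[|[|[|[|[|i]]]]] lt_i] //; rewrite !permE /= !permE. Qed.
Lemma perm_pairing2E i : nat_of_ord (perm_pairing2 i) = nth 0%N lpairing2 i.
Proof. by case: i => [[|[|[|[|[|i]]]]] lt_i] //; rewrite !permE /= !permE. Qed.
Lemma perm_cyc3E i : nat_of_ord (perm_cyc3 i) = nth 0%N lcyc3 i.
Proof. by case: i => [[|[|[|[|[|i]]]]] lt_i] //; rewrite !permE /= !permE. Qed.
Lemma perm_cyc5E i : nat_of_ord (perm_cyc5 i) = nth 0%N lcyc5 i.
Proof. by case: i => [[|[|[|[|[|i]]]]] lt_i] //; rewrite !permM /=  !permE. Qed.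

Definition gen_pairing1 : ambient := @explicit shift1 perm_pairing1 (lsign 1) isT.
Definition gen_pairing2 : ambient := @explicit shift1 perm_pairing2 (lsign 2) isT.
Definition gen_cyc3 : ambient := @explicit shift3 perm_cyc3 lcyc isT.
Definition gen_cyc5 : ambient := @explicit shift5 perm_cyc5 lrot isT.

Lemma gen_pairing1_in : gen_pairing1 \in elusive_group.
Proof.
apply: explicit_in perm_pairing1E _ _.
- by rewrite !odd_permM !odd_tperm -!val_eqE.
- by rewrite !big_ord_recl big_ord0.
- by vm_compute.
Qed.
Lemma gen_pairing2_in : gen_pairing2 \in elusive_group.
Proof.
apply: explicit_in perm_pairing2E _ _.
- by rewrite !odd_permM !odd_tperm -!val_eqE.
- by rewrite !big_ord_recl big_ord0.
- by vm_compute.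
Qed.
Lemma gen_cyc3_in : gen_cyc3 \in elusive_group.
Proof.
apply: explicit_in perm_cyc3E _ _.
- by rewrite !odd_permM !odd_tperm -!val_eqE.
- by rewrite !big_ord_recl big_ord0.
- by vm_compute.
Qed.
Lemma gen_cyc5_in : gen_cyc5 \in elusive_group.
Proof.
apply: explicit_in perm_cyc5E _ _.
- by rewrite !odd_permM !odd_tperm -!val_eqE.
- by rewrite !big_ord_recl big_ord0.
- by vm_compute.
Qed.

(** * The kernel of the projection to A_5, described by congruences *)

Lemma mono5_lmx c l :
  mono5 c (lmx l) = has (fun v => lcong 5 l (lmono v (c %% 3))) (iota 0 4).
Proof. by apply: eq_has => v; rewrite /= lmx_cong /lmono modn_mod. Qed.

Lemma mono5_eq5 c (M M' : 'M['Z_25]_3) : (M *+ 5 = M' *+ 5)%R -> mono5 c M = mono5 c M'.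
Proof. by rewrite /mono5 => ->. Qed.

Lemma iota_mod m d : 0 < d -> m %% d \in iota 0 d.
Proof. by move=> d_gt0; rewrite mem_iota ltn_mod. Qed.

(** Modulo 5 the matrix lies in A_5 and fixes frames 0, 1 and 2; an even permutation of five points
    that fixes three of them is trivial. *)
Lemma respects_fix_eq1 x : (forall i, respects x i) -> aperm5 x = 1 ->
  (amx x *+ 5 = 1%:M *+ 5)%R.
Proof.
move=> rx sx1.
have rxl (i : 'I_5) l : (amx x *+ 5 = lmx l *+ 5)%R ->
    has (fun c => has (fun v => lcong 5 (lmul (lmul (lframe i) l) (ltr (lframe i)))
                                        (lmono v c)) (iota 0 4)) (iota 0 3).
  move=> eq_x; apply/hasP; exists (ashift x i %% 3); rewrite ?iota_mod //.
  rewrite -mono5_lmx -!lmx_mul -lmx_tr.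
  have := rx i; rewrite /respects sx1 perm1.
  rewrite (@mono5_eq5 _ _ (frame i *m lmx l *m (frame i)^T)%R); first exact.
  by rewrite mulmxMnl mulmxMnr eq_x -mulmxMnr -mulmxMnl.
have /allP chk : all (fun v => all (fun c =>
    [&& has (fun c' => has (fun w => lcong 5
          (lmul (lmul (lframe 1) (lmono v c)) (ltr (lframe 1))) (lmono w c'))
          (iota 0 4)) (iota 0 3)
      & has (fun c' => has (fun w => lcong 5
          (lmul (lmul (lframe 2) (lmono v c)) (ltr (lframe 2))) (lmono w c'))
          (iota 0 4)) (iota 0 3)]
    ==> lcong 5 (lmono v c) l1) (iota 0 3)) (iota 0 4) by vm_compute.
have := rx (ord5 0); rewrite /respects sx1 perm1 /frame lmx1 mul1mx trmx1 mulmx1.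
case/hasP=> v v4 /eqP eq_v.
have eq_v3 : (amx x *+ 5 = lmx (lmono v (ashift x (ord5 0) %% 3)) *+ 5)%R.
  by rewrite eq_v /lmono modn_mod.
have /implyP := allP (chk v v4) _ (iota_mod (ashift x (ord5 0)) (isT : 0 < 3)).
rewrite -lmx_cong lmx1 -eq_v3 => chk1; apply/eqP/chk1.
by rewrite (rxl (ord5 1) _ eq_v3) (rxl (ord5 2) _ eq_v3).
Qed.

(** The identity matrix has trivial cubic character, so the shift is divisible by 3. *)
Lemma respects_fix_shift x i : respects x i -> aperm5 x i = i ->
  (amx x *+ 5 = 1%:M *+ 5)%R -> (ashift x i *+ 3 = 0)%R.
Proof.
rewrite /respects => rx sxi x1; move: rx; rewrite sxi.
rewrite (@mono5_eq5 _ _ (lmx l1)); last first.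
  by rewrite mulmxMnl mulmxMnr x1 -mulmxMnr mulmx1 -mulmxMnl frame_tr lmx1.
rewrite mono5_lmx => chk.
have /allP/(_ _ (iota_ord (ashift x i))) : all (fun c =>
    has (fun v => lcong 5 l1 (lmono v (c %% 3))) (iota 0 4) ==> (3 %| c)) (iota 0 9).
  by vm_compute.
rewrite chk /= => /dvdnP[k eq_k]; apply: val_inj.
by rewrite -(natr_Zp (ashift x i)) eq_k -mulrnA /= (@val_Zp_nat 9) // -mulnA modnMl.
Qed.

(** Two distinct frames never differ by a monomial matrix modulo 5, as they represent distinct
    cosets of A_4. *)
Lemma respects_eq1_fix x i : respects x i -> (amx x *+ 5 = 1%:M *+ 5)%R ->
  aperm5 x i = i.
Proof.
rewrite /respects => rx x1; move: rx.
rewrite (@mono5_eq5 _ _ (lmx (lmul (lframe i) (ltr (lframe (aperm5 x i)))))); last first.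
  by rewrite mulmxMnl mulmxMnr x1 -mulmxMnr mulmx1 -mulmxMnl -lmx_mul -lmx_tr.
rewrite mono5_lmx => chk.
have /allP/(_ _ (iota_ord i)) : all (fun i => all (fun j => all (fun c =>
    has (fun v => lcong 5 (lmul (lframe i) (ltr (lframe j))) (lmono v c)) (iota 0 4)
    ==> (j == i)) (iota 0 3)) (iota 0 5)) (iota 0 5).
  by vm_compute.
move/allP/(_ _ (iota_ord (aperm5 x i)))/allP/(_ _ (iota_mod (ashift x i) (isT : 0 < 3))).
by rewrite chk => /eqP/val_inj.
Qed.

Lemma kernel_sub x : x \in elusive_group -> aperm5 x = 1 ->
  (amx x *+ 5 = 1%:M *+ 5)%R /\ forall i, (ashift x i *+ 3 = 0)%R.
Proof.
case/elusive_setP=> _ _ rx sx1; have x1 := respects_fix_eq1 rx sx1.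
by split=> // i; apply: respects_fix_shift (rx i) _ x1; rewrite sx1 perm1.
Qed.

Lemma eq1_kernel x : x \in elusive_group -> (amx x *+ 5 = 1%:M *+ 5)%R ->
  aperm5 x = 1.
Proof.
case/elusive_setP=> _ _ rx x1; apply/permP=> i.
by rewrite perm1 (respects_eq1_fix (rx i)).
Qed.

Lemma kernel_in x : aperm5 x = 1 -> (\sum_i ashift x i = 0)%R ->
    (amx x *+ 5 = 1%:M *+ 5)%R -> (forall i, (ashift x i *+ 3 = 0)%R) ->
  x \in elusive_group.
Proof.
move=> sx1 sum_x x1 dx; apply/elusive_setP; split=> // [|i].
  by rewrite sx1 odd_perm1.
rewrite /respects sx1 perm1 (@mono5_eq5 _ _ (lmx l1)); last first.
  by rewrite mulmxMnl mulmxMnr x1 -mulmxMnr mulmx1 -mulmxMnl frame_tr lmx1.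
rewrite mono5_lmx; apply/hasP; exists 0%N => //.
have /allP/(_ _ (iota_ord (ashift x i))) : all (fun c =>
    ((c * 3) %% 9 == 0)%N ==> lcong 5 l1 (lmono 0 (c %% 3))) (iota 0 9).
  by vm_compute.
move/implyP; apply; apply/eqP.
by rewrite -(@val_Zp_nat 9 isT (_ * 3)) mulrnA natr_Zp dx.
Qed.

Definition perm_part := Morphism (D := elusive_group) (in2W aperm5M).

Definition elusive_kernel := ('ker perm_part)%G.

Lemma elusive_kernelP x :
  reflect (x \in elusive_group /\ aperm5 x = 1) (x \in elusive_kernel).
Proof.
apply: (iffP idP) => [kx | [Gx sx]]; first by have /= := mker kx; have := dom_ker kx.
by apply/kerP.
Qed.

(** * Coordinates on the kernel: the isomorphism with C_3^4 x C_5^3 *)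

Definition emb3 (a : Cyc 3) : 'Z_9 := (a * 3)%:R%R.
Definition emb5 (a : Cyc 5) : 'Z_25 := (a * 5)%:R%R.

Lemma emb3M a b : emb3 (a * b) = (emb3 a + emb3 b)%R.
Proof.
rewrite /emb3 -natrD -mulnDl; apply: val_inj.
by rewrite /= !(@val_Zp_nat 9) // (muln_modl 3 (a + b) 3) modn_mod.
Qed.

Lemma emb5M a b : emb5 (a * b) = (emb5 a + emb5 b)%R.
Proof.
rewrite /emb5 -natrD -mulnDl; apply: val_inj.
by rewrite /= !(@val_Zp_nat 25) // (muln_modl 5 (a + b) 5) modn_mod.
Qed.

Lemma emb5_inj : injective emb5.
Proof.
move=> a b /(congr1 val); rewrite /= !(@val_Zp_nat 25) //.
rewrite -!(muln_modl 5 _ 5) => /eqP; rewrite eqn_pmul2r // => /eqP.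
by rewrite !modn_small // => /val_inj.
Qed.

Lemma emb3_mulrn3 a : (emb3 a *+ 3 = 0)%R.
Proof. by rewrite -mulrnA -mulnA -[(3 * 3)%N]/9 mulrnA -mulrnAC pchar_Zp ?mul0rn. Qed.

Lemma emb5_mulrn5 a : (emb5 a *+ 5 = 0)%R.
Proof. by rewrite -mulrnA -mulnA -[(5 * 5)%N]/25 mulrnA -mulrnAC pchar_Zp ?mul0rn. Qed.

Lemma emb3_surj (z : 'Z_9) : (z *+ 3 = 0)%R -> exists a, z = emb3 a.
Proof.
move=> z3; have [n def_z] : exists n, z = (n * 3)%:R%R.
  have /eqP := congr1 val z3; rewrite -(natr_Zp z) -mulrnA /= (@val_Zp_nat 9) //.
  rewrite -[(_ == _)%N]/(3 * 3 %| z * 3) dvdn_pmul2r // => /dvdnP[n def_z].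
  by exists n; rewrite def_z.
exists (inZp n); rewrite def_z; apply: val_inj.
by rewrite /= !(@val_Zp_nat 9) // (muln_modl 3 n 3) modn_mod.
Qed.

Lemma emb5_surj (z : 'Z_25) : (z *+ 5 = 0)%R -> exists a, z = emb5 a.
Proof.
move=> z5; have [n def_z] : exists n, z = (n * 5)%:R%R.
  have /eqP := congr1 val z5; rewrite -(natr_Zp z) -mulrnA /= (@val_Zp_nat 25) //.
  rewrite -[(_ == _)%N]/(5 * 5 %| z * 5) dvdn_pmul2r // => /dvdnP[n def_z].
  by exists n; rewrite def_z.
exists (inZp n); rewrite def_z; apply: val_inj.
by rewrite /= !(@val_Zp_nat 25) // (muln_modl 5 n 5) modn_mod.
Qed.
Lemma emb5_mul a b : (emb5 a * emb5 b = 0)%R.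
Proof. by rewrite [emb5 b]/emb5 natrM mulrA -(mulrC 5%:R)%R mulrA mulr_natl emb5_mulrn5 mul0r. Qed.

Definition skew_basis k : 'M['Z_25]_3 :=
  nth 0%R [:: delta_mx 0 1 - delta_mx 1 0; delta_mx 0 (inord 2) - delta_mx (inord 2) 0;
              delta_mx 1 (inord 2) - delta_mx (inord 2) 1]%R k.

Definition skew5 (y : C5_3) : 'M['Z_25]_3 :=
  (emb5 y.1.1 *: skew_basis 0 + emb5 y.1.2 *: skew_basis 1 + emb5 y.2 *: skew_basis 2)%R.

Lemma skewM y z : skew5 (y * z) = (skew5 y + skew5 z)%R.
Proof.
case: y z => [[a b] c] [[a' b'] c'].
rewrite -[_ * _]/(a * a', b * b', c * c') /skew5 /=.
move: (skew_basis 0) (skew_basis 1) (skew_basis 2) => X Y Z.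
rewrite (emb5M a) (emb5M b) (emb5M c) !scalerDl [RHS]addrACA; congr (_ + _)%R.
by rewrite [RHS]addrACA.
Qed.

(** Both factors are multiples of 5. Hence [1%:M + skew5 y] turns sums into products, and it is
    orthogonal because [skew5 y] is skew. *)
Lemma skew_mul y z : (skew5 y *m skew5 z = 0)%R.
Proof.
rewrite /skew5; move: (skew_basis 0) (skew_basis 1) (skew_basis 2) => X Y Z.
move: (emb5_mul y.1.1) (emb5_mul y.1.2) (emb5_mul y.2).
move: (emb5 y.1.1) (emb5 y.1.2) (emb5 y.2) => a b c /(_ _)a0 /(_ _)b0 /(_ _)c0.
have E d (A B : 'M['Z_25]_3) e : (forall x, d * emb5 x = 0)%R ->
    ((d *: A) *m (emb5 e *: B) = 0)%R.
  by move=> d0; rewrite -scalemxAl -scalemxAr scalerA d0 scale0r.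
by rewrite !mulmxDl !mulmxDr !E // !addr0.
Qed.

Lemma skew_tr y : ((skew5 y)^T = - skew5 y)%R.
Proof.
have trX k : k < 3 -> ((skew_basis k)^T = - skew_basis k)%R.
  rewrite /skew_basis; case: k => [|[|[|]]] // _ /=.
  1-3: by rewrite raddfB /= !trmx_delta opprB.
have trZ c k : k < 3 -> ((c *: skew_basis k)^T = - (c *: skew_basis k))%R.
  by move=> k3; rewrite -scalerN -trX //; apply/matrixP=> i j; rewrite !mxE.
have trD (A B : 'M['Z_25]_3) : ((A + B)^T = A^T + B^T)%R.
  by apply/matrixP=> i j; rewrite !mxE.
by rewrite /skew5 !trD !trZ // -!opprD.
Qed.

Lemma skew_orth y : ((1%:M + skew5 y) *m (1%:M + skew5 y)^T == 1%:M)%R.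
Proof.
by rewrite linearD /= trmx1 skew_tr mulmxDl mul1mx mulmxBr mulmx1 skew_mul subr0 subrK.
Qed.

Definition wshift (u : C3_4) (i : 'I_5) : 'Z_9 :=
  (emb3 u.1.1.1 *+ coef 0 i + emb3 u.1.1.2 *+ coef 1 i
   + emb3 u.1.2 *+ coef 2 i + emb3 u.2 *+ coef 3 i)%R.

Lemma wshiftM u v i : wshift (u * v) i = (wshift u i + wshift v i)%R.
Proof.
rewrite /wshift !emb3M !mulrnDl [RHS]addrACA; congr (_ + _)%R.
by rewrite [RHS]addrACA; congr (_ + _)%R; rewrite [RHS]addrACA.
Qed.

Definition kernel_elt (u : NType) : ambient :=
  ([ffun i => wshift u.1 i], 1, Orth3 (skew_orth u.2)).

Lemma ashift_kernel_elt u i : ashift (kernel_elt u) i = wshift u.1 i.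
Proof. exact: ffunE. Qed.

Lemma amx_kernel_elt u : amx (kernel_elt u) = (1%:M + skew5 u.2)%R.
Proof. by []. Qed.

Lemma kernel_eltM : {in [set: NType] &, {morph kernel_elt : u v / u * v}}.
Proof.
move=> u v _ _; apply: ambient_inj => [i||].
- by rewrite ashiftM !ashift_kernel_elt perm1 wshiftM.
- by rewrite aperm5M mulg1.
rewrite amxM !amx_kernel_elt mulmxDl mul1mx mulmxDr mulmx1 skew_mul addr0.
by rewrite -addrA (addrC (skew5 _)) skewM.
Qed.

Canonical kernel_elt_morphism := Morphism kernel_eltM.

Lemma skew_entries y :
  [/\ skew5 y 0 1 = emb5 y.1.1, skew5 y 0 (inord 2) = emb5 y.1.2
    & skew5 y 1 (inord 2) = emb5 y.2]%R.
Proof.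
have [d1 d2] : ((1 == inord 2 :> 'I_3) = false /\ (0 == inord 2 :> 'I_3) = false)%R.
  by split; apply/eqP=> /(congr1 val); rewrite /= inordK.
have d2' : (inord 2 == 0 :> 'I_3)%R = false by rewrite eq_sym.
have d1' : (inord 2 == 1 :> 'I_3)%R = false by rewrite eq_sym.
by split; rewrite /skew5 !mxE /= ?eqxx ?d1 ?d2 ?d1' ?d2' /= 
   ?(subr0, sub0r, oppr0, mulr1, mulr0, add0r, addr0).
Qed.

Lemma skew_inj : injective skew5.
Proof.
move=> [[a b] c] [[a' b'] c'] eq_skew.
have [/= e1 e2 e3] := skew_entries (a, b, c).
have [/=] := skew_entries (a', b', c'); rewrite -eq_skew e1 e2 e3.
by move=> /emb5_inj-> /emb5_inj-> /emb5_inj->.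
Qed.

Lemma wshiftE a b c t i : wshift (a, b, c, t) i = (shiftcoef a b c t i * 3)%:R%R.
Proof.
by rewrite /wshift /emb3 -!mulrnA -!natrD !(mulnAC _ 3) -!mulnDl.
Qed.

Lemma Z3_forall4 (P : nat -> nat -> nat -> nat -> bool) :
    all (fun a => all (fun b => all (fun c => all (P a b c) (iota 0 3))
      (iota 0 3)) (iota 0 3)) (iota 0 3) ->
  forall a b c t : 'Z_3, P a b c t.
Proof.
move=> chk a b c t.
exact: (allP (allP (allP (allP chk _ (iota_ord a)) _ (iota_ord b)) _ (iota_ord c)) _ (iota_ord t)).
Qed.

Lemma kernel_elt_inj : 'injm kernel_elt.
Proof.
apply/subsetP=> -[[[[a b] c] t] y] ku; have {}ku := mker ku; rewrite inE.
have y1 : y = 1.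
  apply/skew_inj/(addrI 1%:M%R); rewrite -(amx_kernel_elt (a, b, c, t, y)) ku.
  rewrite amx1 (_ : skew5 1 = 0%R) ?addr0 //.
  by apply: (addIr (skew5 1)); rewrite -skewM mulg1 add0r.
(* Linear independence of the rows of [lcoef] over F_3, by enumeration. *)
have chk := Z3_forall4 (P := fun a b c t =>
  all (fun i => 3 %| shiftcoef a b c t i) (iota 0 5)
  ==> [&& a == 0, b == 0, c == 0 & t == 0])%N.
have {chk} := chk isT a b c t; rewrite implybE; case/orP=> [/negP[] | ].
  apply/allP=> i; rewrite mem_iota => i5.
  have := ashift_kernel_elt (a, b, c, t, y) (@Ordinal 5 i i5).
  rewrite ku ashift1 wshiftE => /esym/(congr1 val)/eqP; rewrite /= (@val_Zp_nat 9) //.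
  by rewrite -[(_ == _)%N]/(3 * 3 %| _ * 3) dvdn_pmul2r.
case/and4P=> /eqP a0 /eqP b0 /eqP c0 /eqP t0; apply/eqP; rewrite y1.
by congr (_, _, _, _, _); apply: val_inj.
Qed.

Lemma wshift_surj (d : 'I_5 -> 'Z_9) :
  (forall i, d i *+ 3 = 0)%R -> (\sum_i d i = 0)%R -> exists u, d =1 wshift u.
Proof.
move=> d3 sum_d.
have [e def_d] : exists e : {ffun 'I_5 -> 'Z_3}, forall i, d i = emb3 (e i).
  have /fin_all_exists[e def_d] i := emb3_surj (d3 i).
  by exists (finfun e) => i; rewrite ffunE def_d.
pose e_ k : nat := e (ord5 k).
(* [t] is the linear form that vanishes on the first three basis vectors and is 1 on the fourth.
   Entry 0 of a vector is its third coordinate; entries 1 and 3 then determine the first two. *)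
pose t := (e_ 1 + e_ 2 + 2 * e_ 3 + 2 * e_ 4)%N.
exists (inZp (e_ 1 + e_ 0 + 2 * t)%N, inZp (e_ 3 + e_ 0 + t)%N, inZp (e_ 0%N), inZp t) => i.
have e_nth j : nat_of_ord (e j) = nth 0%N [:: e_ 0; e_ 1; e_ 2; e_ 3; e_ 4]%N j.
  by case: j => [[|[|[|[|[|j]]]]] lt_j] //=; congr (nat_of_ord (e _)); apply: val_inj.
have sum_e : (3 %| e_ 0 + e_ 1 + e_ 2 + e_ 3 + e_ 4)%N.
  have /eqP := congr1 val sum_d; under eq_bigr do rewrite def_d /emb3 e_nth.
  rewrite !big_ord_recl big_ord0 addr0 -!natrD -!mulnDl /= (@val_Zp_nat 9) //.
  by rewrite -[(_ == _)%N]/(3 * 3 %| _ * 3)%N dvdn_pmul2r // !addnA.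
have chk := Z3_forall4 (P := fun e0 e1 e2 e3 => all (fun e4 =>
  let t := (e1 + e2 + 2 * e3 + 2 * e4)%N in
  (3 %| e0 + e1 + e2 + e3 + e4) ==> all (fun i => nth 0 [:: e0; e1; e2; e3; e4] i ==
   shiftcoef ((e1 + e0 + 2 * t) %% 3) ((e3 + e0 + t) %% 3) (e0 %% 3) (t %% 3) i %[mod 3])%N
  (iota 0 5)) (iota 0 3)).
have := chk isT (e (ord5 0)) (e (ord5 1)) (e (ord5 2)) (e (ord5 3)).
move/allP/(_ _ (iota_ord (e (ord5 4)))).
rewrite sum_e => /allP/(_ _ (iota_ord i)); rewrite -e_nth => /eqP eq_mod.
rewrite wshiftE def_d; apply: val_inj; rewrite /= !(@val_Zp_nat 9) //.
by rewrite -!(muln_modl 3 _ 3) eq_mod.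
Qed.

Lemma skew3_eq (A B : 'M['Z_25]_3) : (A^T = - A)%R -> (B^T = - B)%R ->
    (A 0 1 = B 0 1)%R -> (A 0 (inord 2) = B 0 (inord 2))%R ->
    (A 1 (inord 2) = B 1 (inord 2))%R -> A = B.
Proof.
have skewE (C : 'M['Z_25]_3) : (C^T = - C)%R -> forall i j, (C j i = - C i j)%R.
  by move=> trC i j; have := congr1 (fun D : 'M_3 => D i j) trC; rewrite !mxE.
have diag0 (C : 'M['Z_25]_3) : (C^T = - C)%R -> forall i, (C i i = 0)%R.
  move=> trC i; have: (C i i *+ 2 = 0)%R by rewrite mulr2n {1}(skewE C trC) addNr.
  (* 13 is the inverse of 2 modulo 25. *)
  move/(congr1 (fun z => z *+ 13)%R); rewrite -mulrnA mul0rn.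
  by rewrite -[(2 * 13)%N]/(25 + 1) mulrnDr -[X in (X + _)%R]mulr_natr pchar_Zp ?mulr0 ?add0r.
move=> trA trB e01 e02 e12; apply/matrixP=> i j.
have o2 (k : 'I_3) : (k = 2 :> nat)%N -> k = inord 2.
  by move=> k2; apply: val_inj; rewrite /= inordK.
have o1 (k : 'I_3) : (k = 1 :> nat)%N -> k = 1%R by move=> k1; apply: val_inj.
have o0 (k : 'I_3) : (k = 0 :> nat)%N -> k = 0%R by move=> k1; apply: val_inj.
have [/o0->|/o1->|/o2->] : [\/ i = 0 :> nat, i = 1 :> nat | i = 2 :> nat]%N.
  by case: i => [[|[|[|]]]] //=; [constructor 1 | constructor 2 | constructor 3].
all: have [/o0->|/o1->|/o2->] : [\/ j = 0 :> nat, j = 1 :> nat | j = 2 :> nat]%N.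
all: try by case: j => [[|[|[|]]]] //=; [constructor 1 | constructor 2 | constructor 3].
all: rewrite ?diag0 ?e01 ?e02 ?e12 //.
all: by rewrite (skewE A) // (skewE B) // ?e01 ?e02 ?e12.
Qed.

(** With [M = 1 + B] and [B] divisible by 5, the product of [B] and its transpose vanishes, so
    orthogonality of [M] says exactly that [B] is skew. *)
Lemma skew_surj (M : 'M['Z_25]_3) :
    (M *m M^T = 1%:M)%R -> (M *+ 5 = 1%:M *+ 5)%R ->
  exists y, M = (1%:M + skew5 y)%R.
Proof.
move=> orthM M5.
have [B defM B5] : exists2 B, M = (1%:M + B)%R & forall i j, (B i j *+ 5 = 0)%R.
  exists (M - 1%:M)%R => [|i j]; first by rewrite addrC subrK.
  by rewrite -mulmxnE mulrnBl M5 subrr mxE.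
have BBt : (B *m B^T = 0)%R.
  apply/matrixP=> i j; rewrite !mxE big1 // => k _; rewrite mxE.
  have [a ->] := emb5_surj (B5 i k); have [b ->] := emb5_surj (B5 j k).
  exact: emb5_mul.
have Btr : (B^T = - B)%R.
  apply/eqP; rewrite -addr_eq0 addrC; apply/eqP.
  move: orthM; rewrite defM linearD /= trmx1 mulmxDl mul1mx mulmxDr mulmx1 BBt addr0.
  by rewrite -addrA => /(canRL (addKr _)); rewrite addNr addrC.
have [a Ba] := emb5_surj (B5 0 1)%R; have [b Bb] := emb5_surj (B5 0 (inord 2))%R.
have [c Bc] := emb5_surj (B5 1 (inord 2))%R.
exists (a, b, c); rewrite defM; congr (_ + _)%R.
have [/= e1 e2 e3] := skew_entries (a, b, c).
by apply: skew3_eq; rewrite ?skew_tr ?e1 ?e2 ?e3.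
Qed.

Lemma morphim_kernel_elt : kernel_elt @* [set: NType] = elusive_kernel.
Proof.
apply/setP=> x; apply/morphimP/elusive_kernelP => [[[u y] _ _ ->]|[Gx sx1]].
  have emb5z (z : Cyc 5) (X : 'M['Z_25]_3) : (emb5 z *: X *+ 5 = 0)%R.
    by rewrite scalerMnl emb5_mulrn5 scale0r.
  split=> //; apply: kernel_in => // [||i].
  - case: u => [[[a b] c] t]; under eq_bigr do rewrite ashift_kernel_elt wshiftE.
    rewrite -natr_sum -big_distrl /= !big_ord_recl big_ord0 addn0.
    apply: val_inj; rewrite /= (@val_Zp_nat 9) //; apply/eqP.
    rewrite -[(_ == _)%N]/(3 * 3 %| _ * 3) dvdn_pmul2r //.
    exact: (Z3_forall4 (P := fun a b c t => 3 %| shiftcoef a b c t 0 + (shiftcoef a b c t 1 +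
       (shiftcoef a b c t 2 + (shiftcoef a b c t 3 + shiftcoef a b c t 4))))).
  - by rewrite amx_kernel_elt mulrnDl /skew5 !mulrnDl !emb5z !addr0.
  have emb3z z c : (emb3 z *+ c *+ 3 = 0)%R by rewrite mulrnAC emb3_mulrn3 mul0rn.
  by rewrite ashift_kernel_elt /wshift !mulrnDl !emb3z !addr0.
have [x5 d3] := kernel_sub Gx sx1; have [_ sum_d _] := elusive_setP _ Gx.
have [u def_u] := wshift_surj d3 sum_d.
have [y def_y] := skew_surj (amx_tr x) x5.
exists (u, y); rewrite ?inE //; apply: ambient_inj => [i||] //.
by rewrite ashift_kernel_elt -def_u.
Qed.

Lemma elusive_kernel_isog : elusive_kernel \isog [set: NType].
Proof.
have := sub_isog (subxx [set: NType]) kernel_elt_inj.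
by rewrite morphim_kernel_elt isog_sym.
Qed.

Lemma card_elusive_kernel : #|elusive_kernel| = (3 ^ 4 * 5 ^ 3)%N.
Proof.
by rewrite (card_isog elusive_kernel_isog) cardsT !card_prod !card_ord.
Qed.

(** * The quotient is A_5 *)

Lemma perm_pairing1_order : #[perm_pairing1] = 2.
Proof.
apply: nt_prime_order => //.
  apply/permP=> i; apply: val_inj; rewrite /= !expgS expg0 mulg1 1!permM !perm_pairing1E perm1.
  by case: i => [[|[|[|[|[|i]]]]] lt_i].
by apply/eqP=> /permP/(_ (ord5 1))/(congr1 (@nat_of_ord 5)); rewrite perm_pairing1E perm1.
Qed.

Lemma perm_pairing2_order : #[perm_pairing2] = 2.
Proof.
apply: nt_prime_order => //.
  apply/permP=> i; apply: val_inj; rewrite /= !expgS expg0 mulg1 1!permM !perm_pairing2E perm1.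
  by case: i => [[|[|[|[|[|i]]]]] lt_i].
by apply/eqP=> /permP/(_ (ord5 1))/(congr1 (@nat_of_ord 5)); rewrite perm_pairing2E perm1.
Qed.

Lemma perm_cyc3_order : #[perm_cyc3] = 3.
Proof.
apply: nt_prime_order => //.
  apply/permP=> i; apply: val_inj; rewrite /= !expgS expg0 mulg1 2!permM !perm_cyc3E perm1.
  by case: i => [[|[|[|[|[|i]]]]] lt_i].
by apply/eqP=> /permP/(_ (ord5 1))/(congr1 (@nat_of_ord 5)); rewrite perm_cyc3E perm1.
Qed.

Lemma perm_cyc5_order : #[perm_cyc5] = 5.
Proof.
apply: nt_prime_order => //.
  apply/permP=> i; apply: val_inj; rewrite /= !expgS expg0 mulg1 4!permM !perm_cyc5E perm1.
  by case: i => [[|[|[|[|[|i]]]]] lt_i].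
by apply/eqP=> /permP/(_ (ord5 1))/(congr1 (@nat_of_ord 5)); rewrite perm_cyc5E perm1.
Qed.

Lemma card_Alt5 : #|'Alt_('I_5)| = 60.
Proof. by apply/eqP; rewrite -(eqn_pmul2l (isT : 0 < 2)%N) card_Alt card_ord. Qed.

Lemma perm_pairing_commute : commute perm_pairing1 perm_pairing2.
Proof.
apply/permP=> i; apply: val_inj; rewrite /= [in LHS]permM [in RHS]permM.
rewrite !(perm_pairing1E, perm_pairing2E).
by case: i => [[|[|[|[|[|i]]]]] lt_i].
Qed.

Lemma perm_part_in x : x \in elusive_group -> aperm5 x \in perm_part @* elusive_group.
Proof. by move=> Gx; apply/morphimP; exists x. Qed.

(** The image lies in A_5, and its order is divisible by 4, 3 and 5 because it contains a four-group
    and elements of orders 3 and 5. *)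
Lemma morphim_perm_part : perm_part @* elusive_group = 'Alt_('I_5).
Proof.
apply/eqP; rewrite eqEcard card_Alt5; apply/andP; split.
  apply/subsetP=> _ /morphimP[x _ /elusive_setP[ev_x _ _] ->].
  by rewrite Alt_even.
have dvd s : s \in perm_part @* elusive_group -> #[s] %| #|perm_part @* elusive_group|.
  exact: order_dvdG.
have d3 := dvd _ (perm_part_in gen_cyc3_in); have d5 := dvd _ (perm_part_in gen_cyc5_in).
have d4 : 4 %| #|perm_part @* elusive_group|.
  have p1 := perm_part_in gen_pairing1_in; have p2 := perm_part_in gen_pairing2_in.
  have sV : <[perm_pairing1]> <*> <[perm_pairing2]> \subset perm_part @* elusive_group.
    by rewrite join_subG !cycle_subG p1.
  suff eq4: 4 = #|<[perm_pairing1]> <*> <[perm_pairing2]>|.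
    by rewrite [X in X %| _]eq4; apply: cardSg.
  apply: esym.
  rewrite cent_joinEl; last first.
    by rewrite /= cycle_subG /= cent_cycle; apply/cent1P/perm_pairing_commute.
  rewrite TI_cardMg -?orderE ?perm_pairing1_order ?perm_pairing2_order //.
  rewrite prime_TIg -?orderE ?perm_pairing1_order // cycle_subG.
  apply/negP; rewrite /= cycle2g ?perm_pairing2_order // !inE => /orP[]/eqP/permP/(_ (ord5 1)).
    by move/(congr1 (@nat_of_ord 5)); rewrite perm_pairing1E perm1.
  by move/(congr1 (@nat_of_ord 5)); rewrite perm_pairing1E perm_pairing2E.
apply: dvdn_leq => //; rewrite -[60]/(3 * (5 * 4))%N !Gauss_dvd // d4.
by rewrite -[X in (X %| _)%N && _]perm_cyc3_order d3 -[X in (X %| _)%N && _]perm_cyc5_order d5.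
Qed.

Lemma elusive_quotient_isog : elusive_group / elusive_kernel \isog 'Alt_('I_5).
Proof. by rewrite -morphim_perm_part first_isog. Qed.

Lemma card_elusive_group : #|elusive_group| = (3 ^ 4 * 5 ^ 3 * 60)%N.
Proof.
rewrite -(Lagrange (normal_sub (ker_normal perm_part))) card_elusive_kernel.
by rewrite -card_quotient ?normal_norm ?ker_normal // (card_isog elusive_quotient_isog) card_Alt5.
Qed.

Lemma elusive_lift s : s \in 'Alt_('I_5) -> exists2 g, g \in elusive_group & aperm5 g = s.
Proof. by rewrite -morphim_perm_part => /morphimP[x _ Gx ->]; exists x. Qed.

(** * Elements of order 3 or 5 lie in the kernel *)

Lemma lmx_skew (a b c : Cyc 5) :
  (1%:M + skew5 (a, b, c) = lmx (lskew a b c))%R.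
Proof.
(* Without the identity both sides are skew, so three entries decide. *)
apply: (addrI (- 1%:M)%R); rewrite addKr addrC.
have [/= e1 e2 e3] := skew_entries (a, b, c).
have v2 : nat_of_ord (inord 2 : 'I_3) = 2 by rewrite inordK.
apply: skew3_eq; first exact: skew_tr.
- rewrite raddfB /= trmx1 opprB lmx_tr; apply/eqP; rewrite subr_eq addrAC eq_sym subr_eq.
  have mod25l k : (20 * k + 5 * k) %% 25 = 0 by rewrite -mulnDl modnMr.
  have mod25r k : (5 * k + 20 * k) %% 25 = 0 by rewrite -mulnDl modnMr.
  apply/eqP/matrixP=> i j; rewrite !mxE -!natrD; apply/eqP; rewrite Z25_nat_eq.
  case: i j => [[|[|[|i]]] lt_i] // [[|[|[|j]]] lt_j] //=.
  - exact/eqP/esym/(mod25l a).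
  - exact/eqP/esym/(mod25l b).
  - exact/eqP/esym/(mod25r a).
  - exact/eqP/esym/(mod25l c).
  - exact/eqP/esym/(mod25r b).
  exact/eqP/esym/(mod25r c).
- by rewrite e1 !mxE subr0 /emb5 mulnC.
- by rewrite e2 !mxE /= -val_eqE /= v2 subr0 /emb5 mulnC.
by rewrite e3 !mxE /= -val_eqE /= v2 subr0 /emb5 mulnC.
Qed.

Lemma lmx_iter k l : (iter k (mulmx (lmx l)) 1%:M = lmx (iter k (lmul l) l1))%R.
Proof. by elim: k => [|k IHk] /=; rewrite ?lmx1 // IHk lmx_mul. Qed.

Lemma amxX x k : amx (x ^+ k) = iter k (mulmx (amx x)) 1%:M%R.
Proof. by elim: k => [|k IHk] //=; rewrite expgS amxM IHk. Qed.

Lemma aperm5X x k : aperm5 (x ^+ k) = aperm5 x ^+ k.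
Proof. by elim: k => [|k IHk] //; rewrite !expgS aperm5M IHk. Qed.

Lemma aperm5J x y : aperm5 (x ^ y) = aperm5 x ^ aperm5 y.
Proof. by rewrite !conjgE !aperm5M aperm5V. Qed.

(** The number of fixed points of a 3-group on 5 points is congruent to 5 modulo 3, hence
    nonzero. *)
Lemma order3_fix (s : {perm 'I_5}) : s ^+ 3 = 1 -> exists i, s i = i.
Proof.
move=> s3.
have p3 : 3.-group <[s]>.
  by apply: (@pnat_dvd _ (3 ^ 1)); rewrite ?pnatX // -orderE order_dvdn s3.
have acts : [acts <[s]>, on [set: 'I_5] | 'P].
  by apply/actsP=> t _ i; rewrite !inE.
have := pgroup_fix_mod p3 acts; rewrite cardsT card_ord => fix_mod.
have /card_gt0P[i] : 0 < #|'Fix_([set: 'I_5] | 'P)(<[s]>)|.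
  by rewrite lt0n; apply/eqP=> fix0; rewrite fix0 in fix_mod.
rewrite inE => /andP[_ /afixP/(_ s (cycle_id s))]; exists i; exact.
Qed.

(* [x] fixes a frame [l] with [3 * ashift x l = 0], so its matrix acts on that frame as a
   diagonal sign matrix modulo 5; being of order dividing 3 too, it is trivial modulo 5. *)
Lemma order3_kernel x : x \in elusive_group -> x ^+ 3 = 1 -> aperm5 x = 1.
Proof.
move=> Gx x3; apply: (eq1_kernel Gx).
have [l sl] : exists l, aperm5 x l = l by apply: order3_fix; rewrite -aperm5X x3.
have dl : (ashift x l *+ 3 = 0)%R.
  have := congr1 (fun y => ashift y l) x3; rewrite ashift1 !expgS expg0 mulg1 !ashiftM.
  by rewrite !sl !mulrSr mulr0n add0r addrA.
have [_ _ /(_ l)] := elusive_setP _ Gx; rewrite /respects sl.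
rewrite (@mono5_congr _ 0%N); last first.
  apply/eqP; rewrite mod0n -[(_ == _)%N]/(3 %| _)%N -(dvdn_pmul2r (isT : 0 < 3)%N).
  by rewrite /dvdn -(@val_Zp_nat 9 isT (_ * 3)) mulrnA natr_Zp dl.
case/hasP=> v v4 /eqP; set F := frame l; set M := amx x => eq_v.
have FtF : (F^T *m F = 1%:M)%R by apply/mulmx1C/frame_tr.
have FM2 : (F *m (M *m M) *m F^T *+ 5 = 1%:M *+ 5)%R.
  have -> : (F *m (M *m M) *m F^T = (F *m M *m F^T) *m (F *m M *m F^T))%R.
    by rewrite !mulmxA -(mulmxA _ F^T F)%R FtF mulmx1.
  rewrite mulmxMnl eq_v -mulmxMnl mulmxMnr eq_v -mulmxMnr lmx_mul -lmx1.
  apply/eqP; rewrite lmx_cong.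
  by apply: (allP (_ : all (fun v => lcong 5 (lmul (lmono v 0) (lmono v 0)) l1) (iota 0 4)) v v4).
have M2 : (M *m M *+ 5 = 1%:M *+ 5)%R.
  have -> : (M *m M = F^T *m (F *m (M *m M) *m F^T) *m F)%R.
    by rewrite -!mulmxA FtF mulmx1 !mulmxA FtF mul1mx.
  by rewrite mulmxMnl mulmxMnr FM2 -mulmxMnr mulmx1 -mulmxMnl FtF.
have M3 : (M *m (M *m M) = 1%:M)%R by have := congr1 amx x3.
by rewrite -[M]mulmx1 mulmxMnr -M2 -mulmxMnr M3.
Qed.

Lemma lrot_skew_order5 (a b c : Cyc 5) :
  (iter 5 (mulmx (lmx lrot *m (1%:M + skew5 (a, b, c)))) 1%:M != 1%:M)%R.
Proof.
rewrite lmx_skew lmx_mul lmx_iter -lmx1 lmx_eq.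
have /allP chk : all (fun a => all (fun b => all (fun c =>
    ~~ lcong 1 (iter 5 (lmul (lmul lrot (lskew a b c))) l1) l1) (iota 0 5))
  (iota 0 5)) (iota 0 5) by vm_compute.
exact: (allP (allP (chk _ (iota_ord a)) _ (iota_ord b)) _ (iota_ord c)).
Qed.

Lemma Alt5_Sylow5 s : s \in 'Alt_('I_5) -> #[s] = 5 -> 5.-Sylow('Alt_('I_5)) <[s]>.
Proof.
move=> Alt_s o5; rewrite pHallE cycle_subG Alt_s card_Alt5 -orderE o5.
by rewrite -[60]/(5 ^ 1 * 12)%N p_part lognM.
Qed.

(* By Sylow's theorem in A_5 one may assume that [x] lies over [perm_cyc5], i.e. is one of the
   125 lifts of [lrot]. *)
Lemma order5_kernel x : x \in elusive_group -> x ^+ 5 = 1 -> aperm5 x = 1.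
Proof.
move=> Gx x5; apply/eqP/negPn/negP=> ntx.
have ev y : y \in elusive_group -> aperm5 y \in 'Alt_('I_5).
  by case/elusive_setP=> ev_y _ _; rewrite Alt_even.
have o5 : #[aperm5 x] = 5 by apply: nt_prime_order; rewrite // -aperm5X x5.
have [t At defc] := Sylow_trans (Alt5_Sylow5 (ev x Gx) o5)
  (Alt5_Sylow5 (ev _ gen_cyc5_in) perm_cyc5_order).
have [g Gg def_t] := elusive_lift At.
have /cycleP[k def_c] : perm_cyc5 \in <[aperm5 (x ^ g)]>.
  by rewrite aperm5J def_t cycleJ -defc cycle_id.
pose y := (x ^ g) ^+ k.
have Gy : y \in elusive_group by rewrite groupX ?groupJ.
have y5 : y ^+ 5 = 1 by rewrite /y -expgM mulnC expgM -conjXg x5 conj1g expg1n.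
have : gen_cyc5^-1 * y \in elusive_kernel.
  apply/elusive_kernelP; split; first by rewrite groupM ?groupV ?gen_cyc5_in.
  by rewrite aperm5M aperm5V aperm5X -def_c mulVg.
rewrite -morphim_kernel_elt => /morphimP[[u [[a b] c]] _ _ def_y].
have := lrot_skew_order5 a b c; rewrite -[lmx lrot]/(amx gen_cyc5).
rewrite -(amx_kernel_elt (u, (a, b, c))) -amxM -[kernel_elt _]def_y mulKVg -amxX y5.
by rewrite amx1 eqxx.
Qed.

(** * The product K of two hyperplanes and its conjugates *)

(** The last coordinate is made trivial in both modules. *)
Definition stab_elt (k : KType) : ambient := kernel_elt ((k.1, 1), (k.2, 1)).

Lemma stab_eltM : {in [set: KType] &, {morph stab_elt : k l / k * l}}.
Proof.
move=> k l _ _; rewrite /stab_elt -kernel_eltM ?inE //; congr kernel_elt.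
by congr (_, _, (_, _)); rewrite mulg1.
Qed.
Canonical stab_elt_morphism := Morphism stab_eltM.

Lemma stab_elt_inj : 'injm stab_elt.
Proof.
by apply/injmP=> -[a b] [a' b'] _ _ /(injmP kernel_elt_inj); rewrite !inE => /(_ isT isT)[-> ->].
Qed.

Definition stab_kernel := (stab_elt @* [set: KType])%G.

Lemma stab_kernel_isog : stab_kernel \isog [set: KType].
Proof.
have := sub_isog (subxx [set: KType]) stab_elt_inj.
by rewrite isog_sym.
Qed.

Lemma card_stab_kernel : #|stab_kernel| = (3 ^ 3 * 5 ^ 2)%N.
Proof. by rewrite (card_isog stab_kernel_isog) cardsT !card_prod !card_ord. Qed.

(** The linear form that cuts out the hyperplane of V3. It singles out point 0 and the splitting of
    the other four points into 12 and 34, so its conjugates up to sign correspond to the 15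
    involutions of A_5. *)
Definition pairing (x : ambient) : 'Z_9 :=
  (ashift x (ord5 1) + ashift x (ord5 2) + (ashift x (ord5 3) + ashift x (ord5 4)) *+ 2)%R.

Lemma kernel_elt_in u : kernel_elt u \in elusive_kernel.
Proof. by rewrite -morphim_kernel_elt mem_morphim ?inE. Qed.

Lemma stab_kernel_sub : stab_kernel \subset elusive_kernel.
Proof. by apply/subsetP=> _ /morphimP[k _ _ ->]; apply: kernel_elt_in. Qed.

Lemma natr9_eq0 n : ((n * 3)%:R == 0 :> 'Z_9)%R = (3 %| n).
Proof.
rewrite -val_eqE /= (@val_Zp_nat 9) // -[(_ == _)%N]/(3 * 3 %| n * 3)%N.
by rewrite dvdn_pmul2r.
Qed.

Lemma stab_kernelE x : x \in elusive_kernel ->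
  (x \in stab_kernel) = (pairing x == 0)%R && (amx x 1 (inord 2) == 0)%R.
Proof.
rewrite -morphim_kernel_elt => /morphimP[[[[[a b] c] t] [[y0 y1] y2]] _ _ -> {x}].
have -> : (pairing (kernel_elt (a, b, c, t, (y0, y1, y2))) == 0)%R = (t == 1).
  rewrite /pairing !ashift_kernel_elt !wshiftE -!natrD -!mulnDl -mulrnA mulnAC -natrD -mulnDl.
  rewrite natr9_eq0.
  have /eqP chk := Z3_forall4 (P := fun a b c t => (3 %| shiftcoef a b c t 1 + shiftcoef a b c t 2 +
    (shiftcoef a b c t 3 + shiftcoef a b c t 4) * 2) == (t == 0))%N isT a b c t.
  exact: chk.
have -> : (amx (kernel_elt (a, b, c, t, (y0, y1, y2))) 1 (inord 2) == 0)%R = (y2 == 1).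
  have [_ _ e] := skew_entries (y0, y1, y2); rewrite amx_kernel_elt mxE e.
  have d12 : (1 == inord 2 :> 'I_3)%R = false.
    by apply/eqP=> /(congr1 val); rewrite /= inordK.
  rewrite mxE d12 add0r -[0%R in LHS](_ : emb5 1 = _) ?(inj_eq emb5_inj) //.
apply/morphimP/andP=> [[k _ _ /(injmP kernel_elt_inj)] | [/eqP-> /eqP->]].
  by rewrite !inE => /(_ isT isT)[_ -> _ ->].
by exists ((a, b, c), (y0, y1)); rewrite ?inE.
Qed.

Lemma ashift_conj x g i : aperm5 x = 1 -> ashift (x ^ g^-1) i = ashift x (aperm5 g i).
Proof.
move=> sx1; by rewrite conjgE invgK !ashiftM ashiftV sx1 perm1 permK addrC subrK.
Qed.

(** Makes conjugacy into [stab_kernel] decidable by enumeration. Conjugating by [g^-1] reads the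
    shifts at [aperm5 g i], so no permutation has to be inverted. *)
Lemma kernel_conj g (f : nat -> nat) l (a b c t : Cyc 3) (y0 y1 y2 : Cyc 5) :
    g \in elusive_group -> (forall i, nat_of_ord (aperm5 g i) = f i) -> amx g = lmx l ->
  (kernel_elt (a, b, c, t, (y0, y1, y2)) ^ g^-1 \in stab_kernel)
    = conj3 f a b c t && conj5 l y0 y1 y2.
Proof.
move=> Gg def_f def_l; rewrite stab_kernelE; last first.
  by rewrite memJ_norm ?kernel_elt_in // (subsetP (normal_norm (ker_normal perm_part))) ?groupV.
congr andb.
  rewrite /pairing !ashift_conj // !ashift_kernel_elt !wshiftE -!natrD -!mulnDl.
  rewrite -mulrnA mulnAC -natrD -mulnDl natr9_eq0 !def_f /conj3.
  by rewrite [(2 * _)%N]mulnC.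
rewrite conjgE invgK !amxM amxV amx_kernel_elt def_l lmx_skew lmx_tr mulmxA !lmx_mul.
rewrite mxE /conj5 [nat_of_ord (inord 2)]inordK // -[0%R]/(0%:R%R) Z25_nat_eq.
have mod_lmul k h i j : i < 3 -> j < 3 -> lentry (lmul k h) i j %% 25 = lentry (lmul k h) i j.
  by move=> lt_i lt_j; rewrite lentry_build // modn_mod.
by rewrite mod_lmul.
Qed.

Lemma Z5_forall3 (P : nat -> nat -> nat -> bool) :
    all (fun a => all (fun b => all (P a b) (iota 0 5)) (iota 0 5)) (iota 0 5) ->
  forall a b c : 'Z_5, P a b c.
Proof.
move=> chk a b c.
exact: (allP (allP (allP chk _ (iota_ord a)) _ (iota_ord b)) _ (iota_ord c)).
Qed.

(* These 15 elements move the base hyperplanes to all of their conjugates. *)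
Definition sweep (j i : nat) : ambient := gen_cyc3 ^+ j * gen_cyc5 ^+ i.
Lemma sweep_in j i : sweep j i \in elusive_group.
Proof. by rewrite groupM ?groupX ?gen_cyc3_in ?gen_cyc5_in. Qed.

Lemma sweep_permE j i k : nat_of_ord (aperm5 (sweep j i) k) = sweep_perm j i k.
Proof.
rewrite aperm5M !aperm5X permM /sweep_perm.
have -> : iter j (nth 0%N lcyc3) k = (perm_cyc3 ^+ j) k.
  elim: j => [|j /= ->]; first by rewrite expg0 perm1.
  by rewrite -perm_cyc3E expgSr (permM (perm_cyc3 ^+ j)).
elim: i => [|i /= <-]; first by rewrite expg0 perm1.
by rewrite -perm_cyc5E expgSr (permM (perm_cyc5 ^+ i)).
Qed.

Lemma sweep_mxE j i : amx (sweep j i) = lmx (sweep_mx j i).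
Proof. by rewrite amxM !amxX !lmx_iter lmx_mul. Qed.

Definition sweep_conjE j i a b c t y0 y1 y2 := kernel_conj a b c t y0 y1 y2
  (sweep_in j i) (sweep_permE j i) (sweep_mxE j i).

(** Each of the 81 vectors of V3 lies in one of the 15 conjugates of the hyperplane, by
    enumeration. *)
Lemma kernel_cover3 (a b c t : Cyc 3) :
  exists2 g, g \in elusive_group & kernel_elt (a, b, c, t, 1) ^ g \in stab_kernel.
Proof.
have chk : all (fun a => all (fun b => all (fun c => all (fun t =>
    has (fun j => has (fun i => conj3 (sweep_perm j i) a b c t) (iota 0 5)) (iota 0 3))
  (iota 0 3)) (iota 0 3)) (iota 0 3)) (iota 0 3) by vm_compute.
have /hasP[j j3 /hasP[i i5 chk3]] := Z3_forall4 chk a b c t.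
have /allP/(_ j j3)/allP/(_ i i5) chk5 : all (fun j => all (fun i =>
  conj5 (sweep_mx j i) 0 0 0) (iota 0 5)) (iota 0 3) by vm_compute.
exists (sweep j i)^-1; first by rewrite groupV sweep_in.
by rewrite (sweep_conjE j i a b c t 1 1 1) chk3.
Qed.

(** When skew matrices are read as vectors, the 15 hyperplanes are the orthogonal complements of the
    axes of the five frames; enumeration shows that they cover V5. *)
Lemma kernel_cover5 (a b c : Cyc 5) :
  exists2 g, g \in elusive_group & kernel_elt (1, (a, b, c)) ^ g \in stab_kernel.
Proof.
have chk : all (fun a => all (fun b => all (fun c => has (fun j => has (fun i =>
    conj3 (sweep_perm j i) 0 0 0 0 && conj5 (sweep_mx j i) a b c) (iota 0 5)) (iota 0 3))
  (iota 0 5)) (iota 0 5)) (iota 0 5) by vm_compute.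
have /hasP[j _ /hasP[i _ {}chk]] := Z5_forall3 chk a b c.
exists (sweep j i)^-1; first by rewrite groupV sweep_in.
by rewrite (sweep_conjE j i 1 1 1 1 a b c).
Qed.

(** In each module the 15 conjugate hyperplanes already intersect trivially. *)
Lemma kernel_core x : x \in elusive_kernel ->
  (forall g, g \in elusive_group -> x ^ g \in stab_kernel) -> x = 1.
Proof.
rewrite -morphim_kernel_elt => /morphimP[[[[[a b] c] t] [[y0 y1] y2]] _ _ -> {x}] core.
have core_chk j i : conj3 (sweep_perm j i) a b c t && conj5 (sweep_mx j i) y0 y1 y2.
  by rewrite -sweep_conjE core // groupV sweep_in.
have /implyP chk3 := Z3_forall4 (P := fun a b c t =>
  all (fun j => all (fun i => conj3 (sweep_perm j i) a b c t) (iota 0 5)) (iota 0 3)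
  ==> [&& a == 0, b == 0, c == 0 & t == 0])%N isT a b c t.
have /implyP chk5 := Z5_forall3 (P := fun a b c =>
  all (fun j => all (fun i => conj5 (sweep_mx j i) a b c) (iota 0 5)) (iota 0 3)
  ==> [&& a == 0, b == 0 & c == 0])%N isT y0 y1 y2.
have /and4P[/eqP a0 /eqP b0 /eqP c0 /eqP t0] :
    [&& a == 0%N :> nat, b == 0%N :> nat, c == 0%N :> nat & t == 0%N :> nat].
  apply: chk3; apply/allP=> j _; apply/allP=> i _; by have /andP[] := core_chk j i.
have /and3P[/eqP y00 /eqP y10 /eqP y20] :
    [&& y0 == 0%N :> nat, y1 == 0%N :> nat & y2 == 0%N :> nat].
  apply: chk5; apply/allP=> j _; apply/allP=> i _; by have /andP[] := core_chk j i.
rewrite (_ : (a, b, c, t, (y0, y1, y2)) = 1); first exact: morph1.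
by congr (_, _, _, _, (_, _, _)); apply: val_inj.
Qed.

(** * The Klein four-group and the involutions *)

(** List data that determine an element, so that identities between explicit elements can be decided
    by computation. *)
Definition represents (x : ambient) (d s : seq nat) (l : lmatrix) : Prop :=
  [/\ forall i, (ashift x i = (nth 0%N d i)%:R)%R,
      forall i, nat_of_ord (aperm5 x i) = nth 0%N s i & amx x = lmx l].

Lemma representsM x y d e s t l m :
    represents x d s l -> represents y e t m ->
  represents (x * y) [seq (nth 0%N d i + nth 0%N e (nth 0%N s i))%N | i <- iota 0 5]
    [seq nth 0%N t (nth 0%N s i) | i <- iota 0 5] (lmul l m).
Proof.
move=> [dx sx lx] [dy sy ly]; split=> [i|i|].
- rewrite ashiftM dx dy sx -natrD (nth_map 0%N) ?size_iota //.
  by rewrite nth_iota.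
- by rewrite aperm5M permM sy sx (nth_map 0%N) ?size_iota // nth_iota.
by rewrite amxM lx ly lmx_mul.
Qed.

Lemma represents_eq x y d e s t l m :
    represents x d s l -> represents y e t m ->
    all (fun i => (nth 0 d i == nth 0 e i %[mod 9])%N && (nth 0 s i == nth 0 t i)%N)
      (iota 0 5) ->
    lcong 1 l m ->
  x = y.
Proof.
move=> [dx sx lx] [dy sy ly] /allP chk; rewrite -lmx_eq => /eqP eq_lm.
apply: ambient_inj => [i||]; last by rewrite lx ly.
- have /andP[/eqP eq_d _] := chk _ (iota_ord i).
  by rewrite dx dy; apply: val_inj; rewrite /= !(@val_Zp_nat 9).
- apply/permP=> i; apply: val_inj; rewrite /= sx sy.
  by have /andP[_ /eqP] := chk _ (iota_ord i).
Qed.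

Lemma represents_explicit d (s : {perm 'I_5}) l (orth_l : lcong 1 (lmul l (ltr l)) l1) sl :
  (forall i, nat_of_ord (s i) = nth 0%N sl i) -> represents (explicit d s orth_l) d sl l.
Proof. by move=> sE; split=> // i; rewrite /ashift ffunE. Qed.

Lemma represents1 : represents 1 shift1 (iota 0 5) l1.
Proof.
split=> [i|i|]; last by rewrite amx1 lmx1.
  by rewrite ashift1; case: i => [[|[|[|[|[|i]]]]] lt_i].
by rewrite perm1 nth_iota.
Qed.

Definition represents_pairing1 : represents gen_pairing1 _ _ _ :=
  represents_explicit _ _ perm_pairing1E.
Definition represents_pairing2 : represents gen_pairing2 _ _ _ :=
  represents_explicit _ _ perm_pairing2E.
Definition represents_cyc3 : represents gen_cyc3 _ _ _ :=
  represents_explicit _ _ perm_cyc3E.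

Lemma gen_pairing1_sq : gen_pairing1 * gen_pairing1 = 1.
Proof.
exact: represents_eq (representsM represents_pairing1 represents_pairing1)
  represents1 isT isT.
Qed.

Lemma gen_pairing2_sq : gen_pairing2 * gen_pairing2 = 1.
Proof.
exact: represents_eq (representsM represents_pairing2 represents_pairing2)
  represents1 isT isT.
Qed.

Lemma gen_pairing_comm : commute gen_pairing1 gen_pairing2.
Proof.
exact: represents_eq (representsM represents_pairing1 represents_pairing2)
  (representsM represents_pairing2 represents_pairing1) isT isT.
Qed.

(** With the second relation below, this shows that [gen_cyc3] permutes the three involutions of the
    four-group cyclically. *)
Lemma gen_pairing2_conj : gen_cyc3 * gen_pairing2 = gen_pairing1 * gen_cyc3.
Proof.
exact: represents_eq (representsM represents_cyc3 represents_pairing2)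
  (representsM represents_pairing1 represents_cyc3) isT isT.
Qed.

Lemma gen_pairing12_conj :
  gen_cyc3 * gen_pairing1 = gen_pairing1 * gen_pairing2 * gen_cyc3.
Proof.
have r12 := representsM represents_pairing1 represents_pairing2.
exact: represents_eq (representsM represents_cyc3 represents_pairing1)
  (representsM r12 represents_cyc3) isT isT.
Qed.

Definition klein_elt (u : C2_2) : ambient := gen_pairing1 ^+ u.1 * gen_pairing2 ^+ u.2.

Lemma klein_eltM : {in [set: C2_2] &, {morph klein_elt : u v / u * v}}.
Proof.
move=> [a b] [a' b'] _ _; rewrite /klein_elt /=.
have modp (x : ambient) : x * x = 1 -> forall m n : Cyc 2, x ^+ (m * n)%g = x ^+ m * x ^+ n.
  by move=> x2 m n; rewrite -expgD -[RHS](expg_mod _ (x2 : x ^+ 2 = 1)).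
rewrite !modp ?gen_pairing1_sq ?gen_pairing2_sq // !mulgA; congr (_ * _).
rewrite -!mulgA; congr (_ * _).
exact/commuteX2/gen_pairing_comm.
Qed.
Canonical klein_elt_morphism := Morphism klein_eltM.

Lemma aperm5_klein_elt1 u : aperm5 (klein_elt u) = 1 -> u = 1.
Proof.
case: u => [[[|[|a]] lt_a] [[|[|b]] lt_b]] //= /permP/(_ (ord5 1))/(congr1 (@nat_of_ord 5)).
all: rewrite aperm5M !aperm5X permM ?expg0 ?expg1 ?perm1 ?perm_pairing2E ?perm_pairing1E //=.
by move=> _; congr (_, _); apply: val_inj.
Qed.

Lemma klein_elt_inj : 'injm klein_elt.
Proof.
apply/subsetP=> u ku; have {}ku := mker ku.
by rewrite inE (aperm5_klein_elt1 (congr1 aperm5 ku)).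
Qed.

Definition klein := (klein_elt @* [set: C2_2])%G.

Lemma klein_isog : klein \isog [set: C2_2].
Proof. by rewrite isog_sym; have := sub_isog (subxx [set: C2_2]) klein_elt_inj. Qed.

Lemma card_klein : #|klein| = 4.
Proof. by rewrite (card_isog klein_isog) cardsT card_prod !card_ord. Qed.

Lemma klein_elt_in u : klein_elt u \in elusive_group.
Proof. by rewrite groupM ?groupX ?gen_pairing1_in ?gen_pairing2_in. Qed.

Lemma klein_sub : klein \subset elusive_group.
Proof. by apply/subsetP=> _ /morphimP[u _ _ ->]; apply: klein_elt_in. Qed.

Lemma gen_pairing1_order : #[gen_pairing1] = 2.
Proof.
apply: nt_prime_order (gen_pairing1_sq : _ ^+ 2 = 1) _ => //.
apply/eqP=> /(congr1 aperm5)/permP/(_ (ord5 1))/(congr1 (@nat_of_ord 5)).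
by rewrite perm_pairing1E perm1.
Qed.

(** The four-group is a Sylow 2-subgroup, so it contains a conjugate of [x], and [gen_cyc3] fuses
    its three involutions. *)
Lemma involution_conj x : x \in elusive_group -> #[x] = 2 ->
  exists2 g, g \in elusive_group & x ^ g = gen_pairing1.
Proof.
move=> Gx o2.
have sylK : 2.-Sylow(elusive_group) klein.
  by rewrite pHallE klein_sub card_klein card_elusive_group p_part !lognM.
have p2 : 2.-group <[x]> by rewrite /pgroup -orderE o2.
have [|g Gg] := Sylow_Jsub sylK _ p2; first by rewrite cycle_subG.
rewrite -cycleJ cycle_subG => /morphimP[u _ _ def_u].
have ntxg : x ^ g != 1 by rewrite -order_gt1 orderJ o2.
have Gc := gen_cyc3_in.
move: u def_u => [[[|[|a]] lt_a] [[|[|b]] lt_b]] //=.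
- by rewrite /= /klein_elt /= mulg1 => x1; rewrite x1 eqxx in ntxg.
- rewrite /= /klein_elt /= mul1g => def_xg; exists (g * gen_cyc3^-1).
    by rewrite groupM ?groupV.
  by rewrite conjgM def_xg conjgE invgK mulgA gen_pairing2_conj mulgK.
- by rewrite /= /klein_elt /= mulg1 => def_xg; exists g.
rewrite /= /klein_elt /= => def_xg; exists (g * gen_cyc3); first by rewrite groupM.
by rewrite conjgM def_xg conjgE -gen_pairing12_conj mulKg.
Qed.

Lemma stab_kernel_norm g d s l : g \in elusive_group -> represents g d s l ->
    all (fun a => all (fun b => all (fun c => conj3 (nth 0%N s) a b c 0) (iota 0 3))
      (iota 0 3)) (iota 0 3) ->
    all (fun a => all (fun b => conj5 l a b 0) (iota 0 5)) (iota 0 5) ->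
  g \in 'N(stab_kernel).
Proof.
move=> Gg [_ sE lE] /allP chk3 /allP chk5; rewrite -groupV inE.
apply/subsetP=> _ /imsetP[_ /morphimP[[[[a b] c] [y0 y1]] _ _ ->] ->].
rewrite /= /stab_elt (kernel_conj a b c 1 y0 y1 1 Gg sE lE).
rewrite (allP (allP (chk3 _ (iota_ord a)) _ (iota_ord b)) _ (iota_ord c)).
exact: (allP (chk5 _ (iota_ord y0)) _ (iota_ord y1)).
Qed.

Lemma klein_norm : klein \subset 'N(stab_kernel).
Proof.
apply/subsetP=> _ /morphimP[u _ _ ->]; rewrite groupM ?groupX //.
  by apply: (stab_kernel_norm gen_pairing1_in represents_pairing1).
by apply: (stab_kernel_norm gen_pairing2_in represents_pairing2).
Qed.

Lemma aperm5_klein x : x \in klein -> aperm5 x = 1 -> x = 1.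
Proof. by case/morphimP=> u _ _ -> /aperm5_klein_elt1->; rewrite morph1. Qed.

Lemma aperm5_klein_fix x : x \in klein -> aperm5 x (ord5 0) = ord5 0.
Proof.
have p10 : perm_pairing1 (ord5 0) = ord5 0 by apply: val_inj; rewrite /= perm_pairing1E.
have p20 : perm_pairing2 (ord5 0) = ord5 0 by apply: val_inj; rewrite /= perm_pairing2E.
case/morphimP=> u _ _ ->; rewrite aperm5M !aperm5X permM.
have permX0 (s : {perm 'I_5}) k : s (ord5 0) = ord5 0 -> (s ^+ k) (ord5 0) = ord5 0.
  by move=> s0; elim: k => [|k IHk]; rewrite ?perm1 // expgS permM s0.
by rewrite !permX0.
Qed.

Lemma aperm5_kernel x : x \in elusive_kernel -> aperm5 x = 1.
Proof. by case/elusive_kernelP. Qed.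

(** * The point stabilizers and their trivial core *)

Section Stabilizer.

Variable Q : {group ambient}.
Hypothesis sQV : Q \subset klein.

Definition stabilizer := (stab_kernel <*> Q)%G.

Let nKQ : Q \subset 'N(stab_kernel) := subset_trans sQV klein_norm.

Lemma stabilizer_sdprod : stab_kernel ><| Q = stabilizer.
Proof.
rewrite /= norm_joinEr // sdprodE //.
apply/trivgP/subsetP=> x /setIP[Kx Qx]; rewrite inE; apply/eqP.
by apply: aperm5_klein (subsetP sQV x Qx) _; apply/aperm5_kernel/(subsetP stab_kernel_sub).
Qed.

Lemma stabilizer_sub : stabilizer \subset elusive_group.
Proof.
rewrite join_subG (subset_trans stab_kernel_sub (normal_sub (ker_normal perm_part))).
exact: subset_trans sQV klein_sub.
Qed.

Lemma mem_stabilizer x : x \in stabilizer ->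
  aperm5 x (ord5 0) = ord5 0 /\ (aperm5 x = 1 -> x \in stab_kernel).
Proof.
rewrite /= norm_joinEr // => /mulsgP[k q Kk Qq ->].
have k1 : aperm5 k = 1 by apply/aperm5_kernel/(subsetP stab_kernel_sub).
have Vq := subsetP sQV q Qq; rewrite aperm5M k1 mul1g; split.
  exact: aperm5_klein_fix.
by move/(aperm5_klein Vq)->; rewrite mulg1.
Qed.

(** All conjugates of a core element fix point 0, so by transitivity it fixes every point and lies
    in the kernel. There its conjugates lie in [stab_kernel], and [kernel_core] applies. *)
Lemma stabilizer_core : gcore stabilizer elusive_group = 1.
Proof.
apply/trivgP/subsetP=> x Cx; rewrite inE; apply/eqP.
have HxJ g : g \in elusive_group -> x ^ g \in stabilizer.
  move=> Gg; apply: (subsetP (gcore_sub _ elusive_group)).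
  by rewrite memJ_norm // (subsetP (gcore_norm _ _)).
have Gx : x \in elusive_group.
  by have := HxJ 1 (group1 _); rewrite conjg1; apply: (subsetP stabilizer_sub).
have x1 : aperm5 x = 1.
  (* The power [5 - i] of the 5-cycle takes [i] to 0. *)
  apply/permP=> i; rewrite perm1; pose g := sweep 0 (5 - i).
  have gi : aperm5 g i = ord5 0.
    apply: val_inj; rewrite /= sweep_permE.
    by case: i @g => [[|[|[|[|[|i]]]]] lt_i].
  have [fix0 _] := mem_stabilizer (HxJ g (sweep_in _ _)).
  by move: fix0; rewrite aperm5J -{1}gi permJ -gi => /perm_inj.
apply: kernel_core; first exact/elusive_kernelP.
move=> g Gg; have [_] := mem_stabilizer (HxJ g Gg); apply.
by rewrite aperm5J x1 conj1g.
Qed.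

Lemma card_stabilizer : #|stabilizer| = (3 ^ 3 * 5 ^ 2 * #|Q|)%N.
Proof. by rewrite -(sdprod_card stabilizer_sdprod) card_stab_kernel. Qed.

End Stabilizer.

(** * Elements of prime order, non-splitting and the two actions *)

Lemma Cyc3_exp5_eq1 (a : Cyc 3) : a ^+ 5 = 1 -> a = 1.
Proof.
by case: a => [[|[|[|a]]] lt_a] // /(congr1 val) // _; apply: val_inj.
Qed.

Lemma Cyc5_exp3_eq1 (a : Cyc 5) : a ^+ 3 = 1 -> a = 1.
Proof.
by case: a => [[|[|[|[|[|a]]]]] lt_a] // /(congr1 val) // _; apply: val_inj.
Qed.

Lemma expg_pair_eq1 (aT bT : finGroupType) (u : aT * bT) k :
  u ^+ k = 1 -> u.1 ^+ k = 1 /\ u.2 ^+ k = 1.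
Proof.
have fstX : (u ^+ k).1 = u.1 ^+ k by elim: k => // k IHk; rewrite !expgS -IHk.
have sndX : (u ^+ k).2 = u.2 ^+ k by elim: k {fstX} => // k IHk; rewrite !expgS -IHk.
by move=> uk; rewrite -fstX -sndX uk.
Qed.

Lemma kernel_elt_expg_eq1 u k : kernel_elt u ^+ k = 1 -> u ^+ k = 1.
Proof.
rewrite -(morphX kernel_elt_morphism k (in_setT u)) => u1.
by apply: (injmP kernel_elt_inj); rewrite ?inE //= u1 (morph1 kernel_elt_morphism).
Qed.

(** The prime is 2, 3 or 5. Involutions are all conjugate to [gen_pairing1]; an element of order 3
    or 5 lies in V3 or V5 respectively, where the conjugate hyperplanes cover everything. *)
Lemma elusive_group_conj x : x \in elusive_group -> prime #[x] ->
  exists2 g, g \in elusive_group & (x ^ g \in stab_kernel) || (x ^ g == gen_pairing1).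
Proof.
move=> Gx pr_x; have xp := expg_order x.
have : #[x] %| 3 ^ 4 * 5 ^ 3 * 60 by rewrite -card_elusive_group order_dvdG.
rewrite -[60]/(2 ^ 2 * 3 * 5)%N !(Euclid_dvdM, Euclid_dvdX) // !dvdn_prime2 //.
have kerE : aperm5 x = 1 -> exists u, x = kernel_elt u.
  move=> x1; have : x \in elusive_kernel by apply/elusive_kernelP.
  by rewrite -morphim_kernel_elt => /morphimP[u _ _ ->]; exists u.
have o2 : #[x] = 2 -> exists2 g, g \in elusive_group &
    (x ^ g \in stab_kernel) || (x ^ g == gen_pairing1).
  by case/(involution_conj Gx)=> g Gg xg; exists g; rewrite // xg eqxx orbT.
have o3 : #[x] = 3 -> exists2 g, g \in elusive_group &
    (x ^ g \in stab_kernel) || (x ^ g == gen_pairing1).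
  move=> ox; rewrite ox in xp.
  have [[[[[a b] c] t] [[y0 y1] y2]] def_x] := kerE (order3_kernel Gx xp).
  move: xp; rewrite {1}def_x => /kernel_elt_expg_eq1/expg_pair_eq1[_ /expg_pair_eq1[]].
  case/expg_pair_eq1=> /Cyc5_exp3_eq1/= y0_1 /Cyc5_exp3_eq1/= y1_1 /Cyc5_exp3_eq1/= y2_1.
  have [g Gg Kxg] := kernel_cover3 a b c t; exists g => //.
  by apply/orP; left; rewrite def_x y0_1 y1_1 y2_1.
have o5 : #[x] = 5 -> exists2 g, g \in elusive_group &
    (x ^ g \in stab_kernel) || (x ^ g == gen_pairing1).
  move=> ox; rewrite ox in xp.
  have [[[[[a b] c] t] [[y0 y1] y2]] def_x] := kerE (order5_kernel Gx xp).
  move: xp; rewrite {1}def_x => /kernel_elt_expg_eq1/expg_pair_eq1[/expg_pair_eq1[] + + _].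
  case/expg_pair_eq1=> /expg_pair_eq1[] /Cyc3_exp5_eq1/= a1 /Cyc3_exp5_eq1/= b1.
  move=> /Cyc3_exp5_eq1/= c1 /Cyc3_exp5_eq1/= t1.
  have [g Gg Kxg] := kernel_cover5 y0 y1 y2; exists g => //.
  by apply/orP; left; rewrite def_x a1 b1 c1 t1.
by rewrite /= !andbT -!orbA => /or4P[/eqP/o3|/eqP/o5|/eqP/o2|/orP[/eqP/o3|/eqP/o5]].
Qed.

(** A complement would have order 60 and contain an element of order 3, but all of those lie in the
    kernel. *)
Lemma elusive_group_nsplit : ~~ [splits elusive_group, over elusive_kernel].
Proof.
apply/negP=> /splitsP[C /complP[tiNC defG]].
have cardC : #|C| = 60.
  have := TI_cardMg tiNC; rewrite defG card_elusive_group card_elusive_kernel.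
  by move/eqP; rewrite eqn_pmul2l // => /eqP.
have [x Cx ox] : {x | x \in C & #[x] = 3} by apply: Cauchy; rewrite ?cardC.
have Gx : x \in elusive_group by rewrite -defG (subsetP (mulG_subr _ _)).
have Nx : x \in elusive_kernel.
  by apply/elusive_kernelP; rewrite (order3_kernel Gx) // -ox expg_order.
have : x \in elusive_kernel :&: C by rewrite inE Nx.
by rewrite tiNC => /set1P x1; rewrite x1 order1 in ox.
Qed.

(** 900 is the index of [stab_kernel], so [n] is the index of the stabilizer. Since all involutions
    are conjugate to [gen_pairing1], having it in [Q] gives each of them a fixed point. *)
Lemma elusive_stabilizer (Q : {group ambient}) (qT : finGroupType) n :
    Q \subset klein -> gen_pairing1 \in Q -> Q \isog [set: qT] ->
    (n * #|Q|)%N = 900 ->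
  exists X : {group {perm 'I_n}}, elusive X /\
    exists N : {group {perm 'I_n}},
    [/\ N <| X, N \isog [set: NType], X / N \isog 'Alt_('I_5), ~~ [splits X, over N] &
      forall i : 'I_n, exists K Q : {group {perm 'I_n}},
        [/\ K ><| Q = 'C_X[i | 'P], K \isog [set: KType] & Q \isog [set: qT]]].
Proof.
move=> sQV Q1 isoQ cardn.
have <- : #|elusive_group : stabilizer Q| = n.
  apply/eqP; rewrite -(eqn_pmul2l (cardG_gt0 (stabilizer Q))).
  rewrite Lagrange ?stabilizer_sub // card_stabilizer // card_elusive_group.
  rewrite -[X in _ == X]mulnA (mulnC _ n) cardn (expnSr 3 3) (expnSr 5 2).
  by move: (3 ^ 3)%N (5 ^ 2)%N => a b; rewrite mulnACA -(mulnA _ _ 60).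
have conj_stab x : x \in elusive_group -> prime #[x] ->
    exists2 g, g \in elusive_group & x ^ g \in stabilizer Q.
  move=> Gx pr_x; have [g Gg Hxg] := elusive_group_conj Gx pr_x; exists g => //.
  case/orP: Hxg => [Kxg | /eqP->]; first exact/(subsetP (joing_subl _ _)).
  exact/(subsetP (joing_subr _ _)).
exact: (elusive_coset_perm (stabilizer_sub sQV) (stabilizer_core sQV) conj_stab
  (ker_normal perm_part) elusive_kernel_isog elusive_quotient_isog elusive_group_nsplit
  (stabilizer_sdprod sQV) stab_kernel_isog isoQ).
Qed.

Theorem theorem1p4 :
  (exists X : {group {perm 'I_225}},
     elusive X /\
     exists N : {group {perm 'I_225}},
       [/\ N <| X, N \isog [set: NType], (X / N)%g \isog 'Alt_('I_5),
           ~~ [splits X, over N] &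
           forall i : 'I_225, exists K Q : {group {perm 'I_225}},
             [/\ (K ><| Q)%g = 'C_X[i | 'P], K \isog [set: KType]
               & Q \isog [set: C2_2]]]) /\
  (exists X : {group {perm 'I_450}},
     elusive X /\
     exists N : {group {perm 'I_450}},
       [/\ N <| X, N \isog [set: NType], (X / N)%g \isog 'Alt_('I_5),
           ~~ [splits X, over N] &
           forall i : 'I_450, exists K Q : {group {perm 'I_450}},
             [/\ (K ><| Q)%g = 'C_X[i | 'P], K \isog [set: KType]
               & Q \isog [set: Cyc 2]]]).
Proof.
have V1 : gen_pairing1 \in klein.
  apply/morphimP; exists ((1%R, 0%R) : C2_2); rewrite ?inE //.
  by rewrite /= /klein_elt /= mulg1.
(* Degree 225 takes the whole four-group as [Q], degree 450 the subgroup generated by one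
   involution. *)
split; first by apply: elusive_stabilizer klein_isog _; rewrite ?card_klein.
apply: (elusive_stabilizer (Q := <[gen_pairing1]>%G)); rewrite ?cycle_subG ?cycle_id //.
  rewrite isog_cyclic_card ?cycle_cyclic // cardsT card_ord -orderE gen_pairing1_order eqxx andbT.
  by rewrite prime_cyclic // cardsT card_ord.
by rewrite -orderE gen_pairing1_order.
Qed.
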